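(* Let $R$ be an arbitrary commutative ring and $l\geq 3$. The symplectic Steinberg group $\mathrm{StSp}(2l,R)$ can be defined by the set of generators $$\{X(u,v,a)\mid u,v\in V,\ u\text{ is a column of a symplectic elementary matrix},\ \langle u,v\rangle=0,\ a\in R\}$$ and the relations (P1) $X(u,v,a)X(u,w,b)=X(u,v+w,a+b+\langle v,w\rangle)$, for $\langle u,v\rangle=\langle u,w\rangle=0$; (P2) $X(u,va,0)=X(v,ua,0)$, where $\langle u,v\rangle =0$ and $v$ is also a column of a symplectic elementary matrix; (P3) $X(u',v',b)X(u,v,a)X(u',v',b)^{-1}=X(T(u',v',b)u,\,T(u',v',b)v,\,a)$. That is, the group with this presentation is isomorphic to $\mathrm{StSp}(2l,R)$, and, under this isomorphism, the usual generators of $\mathrm{StSp}(2l,R)$ are given by $$X_{ij}(a)=X(e_i,e_{-j}a\varepsilon_{-j},0)\ \text{ for } j\neq -i\ (i\ne j),\qquad X_{i,-i}(a)=X(e_i,0,a),$$ and, moreover, the natural projection $\phi\colon\mathrm{StSp}(2l,R)\to\mathrm{Ep}(2l,R)$ sends $X(u,v,a)$ to $T(u,v,a)$. Furthermore, the following relations are automatically satisfied: (P4) $X(u,ua,0)=X(u,0,2a)$; (P5) $X(ub,0,a)=X(u,0,ab^2)$, whenever $b\in R$ and $ub$ is also a column of a symplectic elementary matrix; (P6) $X(u+v,0,a)=X(u,0,a)X(v,0,a)X(v,ua,0)$ for $\langle u,v\rangle=0$, whenever $v$ and $u+v$ are also columns of symplectic elementary matrices. Here in all relations $u$ and $u'$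 are columns of symplectic elementary matrices and $a,b\in R$; $v,w,v'\in V$ are such that all symbols involved are defined.
   Context: Rings are associative, commutative and unital. $V=R^{2l}$ is the free right $R$-module with basis $e_{-l},\dots,e_{-1},e_1,\dots,e_l$; indices $i,j,h,k$ run over $\{-l,\dots,-1,1,\dots,l\}$. Write $\varepsilon_i=\mathrm{sgn}(i)\in\{1,-1\}$. The symplectic form is the bilinear form with $\langle e_i,e_j\rangle=\varepsilon_i\delta_{i,-j}$, and $\mathrm{Sp}(2l,R)$ is the group of $R$-linear automorphisms of $V$ preserving it. Commutators are $[x,y]=xyx^{-1}y^{-1}$. For $u,v\in V$ with $\langle u,v\rangle=0$ and $a\in R$, $T(u,v,a)\in\mathrm{Sp}(2l,R)$ is the map $w\mapsto w+u(\langle v,w\rangle+a\langle u,w\rangle)+v\langle u,w\rangle$. Put $T_{ij}(a)=T(e_i,e_{-j}a\varepsilon_{-j},0)$ for $i\notin\{\pm j\}$ and $T_{i,-i}(a)=T(e_i,0,a)$. The elementary symplectic group $\mathrm{Ep}(2l,R)$ is the subgroup of $\mathrm{Sp}(2l,R)$ generated by all $T_{ij}(a)$, $i\ne j$, $a\in R$. A column of a symplectic elementary matrix is a vector of the form $ge_i$ with $g\in\mathrm{Ep}(2l,R)$ and some index $i$. The symplectic Steinberg group $\mathrm{StSp}(2l,R)$ is the group generated by symbols $X_{ij}(a)$, $i\neq j$, $a\in R$, subject to the relations (each imposed only when all symbols in it are defined, i.e. no symbol $X_{ii}$ appears): R0: $X_{ij}(a)=X_{-j,-i}(-a\varepsilon_i\varepsilon_j)$;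 R1: $X_{ij}(a)X_{ij}(b)=X_{ij}(a+b)$; R2: $[X_{ij}(a),X_{hk}(b)]=1$ for $h\notin\{j,-i\}$, $k\notin\{i,-j\}$; R3: $[X_{ij}(a),X_{jk}(b)]=X_{ik}(ab)$ for $i\notin\{-j,-k\}$, $j\ne -k$; R4: $[X_{i,-i}(a),X_{-i,j}(b)]=X_{ij}(ab\varepsilon_i)X_{-j,j}(-ab^2)$; R5: $[X_{ij}(a),X_{j,-i}(b)]=X_{i,-i}(2ab\varepsilon_i)$. The natural projection $\phi\colon\mathrm{StSp}(2l,R)\to\mathrm{Ep}(2l,R)$ is the epimorphism $X_{ij}(a)\mapsto T_{ij}(a)$. *)

(* Defs.v *)
From HB Require Import structures.
From mathcomp Require Import all_boot all_order all_algebra.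
From mathcomp Require Import boolp.
From mathcomp Require Import ring zify.

Set Implicit Arguments.
Unset Strict Implicit.
Unset Printing Implicit Defensive.

Import GRing.Theory.

Section Presentation.
Local Open Scope group_scope.

(* A letter (x, false) stands for the generator x, (x, true) for its inverse. *)
Definition word (G : Type) := seq (G * bool).

Definition wgen (G : Type) (x : G) : word G := [:: (x, false)].
Definition winv (G : Type) (w : word G) : word G :=
  rev [seq (p.1, ~~ p.2) | p <- w].
Definition wcomm (G : Type) (w1 w2 : word G) : word G :=
  w1 ++ w2 ++ winv w1 ++ winv w2.

Section Pres.
Variables (G : choiceType) (rel : word G -> word G -> Prop).

Inductive pres_eq : word G -> word G -> Prop :=
| pres_refl w : pres_eq w w
| pres_sym w1 w2 : pres_eq w1 w2 -> pres_eq w2 w1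
| pres_trans w1 w2 w3 : pres_eq w1 w2 -> pres_eq w2 w3 -> pres_eq w1 w3
| pres_cat w1 w1' w2 w2' :
    pres_eq w1 w1' -> pres_eq w2 w2' -> pres_eq (w1 ++ w2) (w1' ++ w2')
| pres_cancel x b : pres_eq [:: (x, b); (x, ~~ b)] [::]
| pres_rel w1 w2 : rel w1 w2 -> pres_eq w1 w2.

Lemma winv_cat (w1 w2 : word G) : winv (w1 ++ w2) = winv w2 ++ winv w1.
Proof. by rewrite /winv map_cat rev_cat. Qed.

Lemma winvK (w : word G) : winv (winv w) = w.
Proof.
rewrite /winv map_rev revK -map_comp; apply: map_id_in => -[x b] _ /=.
by rewrite negbK.
Qed.

Lemma pres_mulwV (w : word G) : pres_eq (w ++ winv w) [::].
Proof.
elim: w => [|[x b] w IHw]; first exact: pres_refl.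
rewrite -cat1s winv_cat -catA.
apply: (pres_trans (w2 := [:: (x, b)] ++ [::] ++ winv [:: (x, b)])).
  apply: pres_cat; first exact: pres_refl.
  by rewrite catA; apply: pres_cat; [exact: IHw | exact: pres_refl].
exact: pres_cancel.
Qed.

Lemma pres_mulVw (w : word G) : pres_eq (winv w ++ w) [::].
Proof. by rewrite -{2}[w]winvK; exact: pres_mulwV. Qed.

Lemma pres_winv (w1 w2 : word G) :
  pres_eq w1 w2 -> pres_eq (winv w1) (winv w2).
Proof.
move=> e12; apply: (pres_trans (w2 := winv w1 ++ (w2 ++ winv w2))).
  rewrite -{1}[winv w1]cats0; apply: pres_cat; first exact: pres_refl.
  exact/pres_sym/pres_mulwV.
rewrite catA -[X in pres_eq _ X]cat0s; apply: pres_cat; last exact: pres_refl.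
apply: (pres_trans (w2 := winv w1 ++ w1)); last exact: pres_mulVw.
by apply: pres_cat; [exact: pres_refl | exact: pres_sym].
Qed.

Definition pres_eqb (w1 w2 : word G) : bool := `[< pres_eq w1 w2 >].

Lemma pres_eqb_equiv : equiv_class_of pres_eqb.
Proof.
split=> [w|w1 w2|w2 w1 w3 /asboolP e12 /asboolP e23].
- exact/asboolP/pres_refl.
- by apply/asboolP/asboolP => /pres_sym.
- exact/asboolP/(pres_trans e12).
Qed.

Canonical pres_equiv := EquivRelPack pres_eqb_equiv.

(* The group < G | rel >, i.e. words modulo the least congruence containing
   rel and the free cancellations. *)
Definition presented := {eq_quot pres_equiv}%qT.
HB.instance Definition _ := Choice.on presented.
HB.instance Definition _ := Quotient.on presented.

Definition pi_pres (w : word G) : presented := (\pi_presented w)%qT.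

Lemma pi_presP (w1 w2 : word G) : pi_pres w1 = pi_pres w2 <-> pres_eq w1 w2.
Proof.
by split=> [/eqmodP/asboolP | e12]; last exact/eqmodP/asboolP.
Qed.

Lemma repr_pres (w : word G) : pres_eq (repr (pi_pres w)) w.
Proof. by apply/pi_presP; rewrite /pi_pres reprK. Qed.

Lemma pi_presK (x : presented) : pi_pres (repr x) = x.
Proof. by rewrite /pi_pres reprK. Qed.

Definition pres_mul (x y : presented) := pi_pres (repr x ++ repr y).
Definition pres_one := pi_pres [::].
Definition pres_inv (x : presented) := pi_pres (winv (repr x)).

Lemma pres_mulE w1 w2 : pres_mul (pi_pres w1) (pi_pres w2) = pi_pres (w1 ++ w2).
Proof. by apply/pi_presP/pres_cat; exact: repr_pres. Qed.

Lemma pres_mulA : associative pres_mul.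
Proof.
move=> x y z; rewrite -[x]pi_presK -[y]pi_presK -[z]pi_presK.
by rewrite !pres_mulE catA.
Qed.

Lemma pres_mul1 : left_id pres_one pres_mul.
Proof. by move=> x; rewrite -[x]pi_presK pres_mulE. Qed.

Lemma pres_mulx1 : right_id pres_one pres_mul.
Proof. by move=> x; rewrite -[x]pi_presK pres_mulE cats0. Qed.

Lemma pres_mulV : left_inverse pres_one pres_inv pres_mul.
Proof.
move=> x; rewrite -{2}[x]pi_presK pres_mulE.
exact/pi_presP/pres_mulVw.
Qed.

Lemma pres_mulxV : right_inverse pres_one pres_inv pres_mul.
Proof.
move=> x; rewrite -{1}[x]pi_presK pres_mulE.
exact/pi_presP/pres_mulwV.
Qed.

HB.instance Definition _ :=
  isGroup.Build presented pres_mulA pres_mul1 pres_mulx1 pres_mulV pres_mulxV.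

Definition pres_gen (x : G) : presented := pi_pres (wgen x).

Lemma pi_presM w1 w2 : pi_pres (w1 ++ w2) = pi_pres w1 * pi_pres w2.
Proof. by rewrite -pres_mulE. Qed.

Section Lift.
Variables (H : groupType) (f : G -> H).

Definition weval (w : word G) : H :=
  foldr (fun p x => (if p.2 then (f p.1)^-1 else f p.1) * x) 1 w.

Lemma weval_cat w1 w2 : weval (w1 ++ w2) = weval w1 * weval w2.
Proof.
by elim: w1 => [|p w1 IHw] /=; rewrite ?mul1g // IHw mulgA.
Qed.

Lemma weval_gen x : weval (wgen x) = f x.
Proof. by rewrite /= mulg1. Qed.

Lemma weval_inv w : weval (winv w) = (weval w)^-1.
Proof.
elim: w => [|[x b] w IHw]; first by rewrite /= invg1.
rewrite -cat1s winv_cat !weval_cat IHw invgM; congr (_ * _).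
by case: b => /=; rewrite !mulg1 // invgK.
Qed.

Hypothesis f_rel : forall w1 w2, rel w1 w2 -> weval w1 = weval w2.

Lemma weval_eq w1 w2 : pres_eq w1 w2 -> weval w1 = weval w2.
Proof.
elim=> // {w1 w2} [w1 w2 w3 _ -> _ -> | w1 w1' w2 w2' _ e1 _ e2 | x b] //.
  by rewrite !weval_cat e1 e2.
by case: b => /=; rewrite mulg1 ?mulVg ?mulgV.
Qed.

Definition pres_lift_fun (x : presented) : H := weval (repr x).

Lemma pres_lift_funM : {morph pres_lift_fun : x y / x * y}.
Proof. by move=> x y; rewrite -weval_cat; exact/weval_eq/repr_pres. Qed.

HB.instance Definition _ :=
  isMultiplicative.Build presented H pres_lift_fun pres_lift_funM.

Definition pres_lift : {multiplicative presented -> H} := pres_lift_fun.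

Lemma pres_lift_gen x : pres_lift (pres_gen x) = f x.
Proof. by rewrite -weval_gen; exact/weval_eq/repr_pres. Qed.

End Lift.
End Pres.

Inductive in_generated (G : groupType) (A : G -> Prop) : G -> Prop :=
| in_generated_mem x : A x -> in_generated A x
| in_generated_one : in_generated A 1
| in_generated_mul x y : in_generated A x -> in_generated A y -> in_generated A (x * y)
| in_generated_inv x : in_generated A x -> in_generated A x^-1.

End Presentation.

Section Symplectic.
Local Open Scope ring_scope.
Variables (R : comPzRingType) (l : nat).

(* i : 'I_(2 * l) stands for the i-th entry (counting from 0) of the list
   -l, ..., -1, 1, ..., l; hence rev_ord is the map i |-> -i. *)
Definition sgn (i : 'I_(2 * l)) : R := if (i < l)%N then -1 else 1.

Definition e_ (i : 'I_(2 * l)) : 'cV[R]_(2 * l) := delta_mx i 0.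

Definition gram : 'M[R]_(2 * l) :=
  \matrix_(i, j) (if j == rev_ord i then sgn i else 0).

Definition spform (u v : 'cV[R]_(2 * l)) : R := (u^T *m gram *m v) 0 0.

Lemma rev_ord_neq (i : 'I_(2 * l)) : rev_ord i != i.
Proof.
by apply/eqP => /(congr1 val) /=; have := ltn_ord i; lia.
Qed.

Lemma sgn_rev i : sgn (rev_ord i) = - sgn i.
Proof.
rewrite /sgn /=; have -> : (2 * l - i.+1 < l)%N = ~~ (i < l)%N.
  by have := ltn_ord i; lia.
by case: (i < l)%N; rewrite ?opprK.
Qed.

Lemma sgn_sqr i : sgn i * sgn i = 1.
Proof. by rewrite /sgn; case: ifP; rewrite ?mulrNN mulr1. Qed.

Lemma spformE u v : spform u v = \sum_i sgn i * (u i 0 * v (rev_ord i) 0).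
Proof.
rewrite /spform -mulmxA mxE; apply: eq_bigr => i _; rewrite !mxE.
rewrite (bigD1 (rev_ord i)) //= big1 ?addr0 => [|j /negbTE nj].
  by rewrite mxE eqxx mulrCA.
by rewrite mxE nj mul0r.
Qed.

Lemma spform_e i j : spform (e_ i) (e_ j) = if i == rev_ord j then sgn i else 0.
Proof.
rewrite spformE (bigD1 i) //= big1 ?addr0 => [|k /negbTE nk]; last first.
  by rewrite mxE nk mul0r mulr0.
rewrite !mxE !eqxx mul1r andbT -(inj_eq rev_ord_inj) rev_ordK.
by case: eqP; rewrite ?mulr1 ?mulr0.
Qed.

Lemma spformDl u v w : spform (u + v) w = spform u w + spform v w.
Proof. by rewrite /spform linearD /= !mulmxDl mxE. Qed.
Lemma spformDr u v w : spform u (v + w) = spform u v + spform u w.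
Proof. by rewrite /spform mulmxDr mxE. Qed.
Lemma spformZl a u v : spform (a *: u) v = a * spform u v.
Proof. by rewrite /spform linearZ /= -!scalemxAl mxE. Qed.
Lemma spformZr a u v : spform u (a *: v) = a * spform u v.
Proof. by rewrite /spform -scalemxAr mxE. Qed.
Lemma spform0l u : spform 0 u = 0.
Proof. by rewrite /spform trmx0 !mul0mx mxE. Qed.
Lemma spform0r u : spform u 0 = 0.
Proof. by rewrite /spform mulmx0 mxE. Qed.

Lemma spform_skew u v : spform v u = - spform u v.
Proof.
rewrite !spformE (reindex_inj rev_ord_inj) -sumrN /=; apply: eq_bigr => i _.
by rewrite rev_ordK sgn_rev mulNr [v _ _ * _]mulrC.
Qed.

Lemma spform_alt u : spform u u = 0.
Proof.
rewrite spformE (bigID (fun i : 'I_(2 * l) => (i < l)%N)) /=.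
rewrite [X in _ + X](reindex_inj rev_ord_inj) /=.
rewrite [X in _ + X](eq_bigl (fun i : 'I_(2 * l) => (i < l)%N)); last first.
  by move=> i; have := ltn_ord i; lia.
rewrite -big_split big1 //= => i _.
by rewrite rev_ordK sgn_rev mulNr [u (rev_ord _) _ * _]mulrC subrr.
Qed.

Lemma spform_inj u u' : (forall v, spform u v = spform u' v) -> u = u'.
Proof.
move=> h; apply/colP => i; have := h (e_ (rev_ord i)).
have spform_ei w : spform w (e_ (rev_ord i)) = sgn i * w i 0.
  rewrite spformE (bigD1 i) //= big1 ?addr0 => [|k nk].
    by rewrite mxE !eqxx mulr1.
  by rewrite mxE (inj_eq rev_ord_inj) (negbTE nk) !mulr0.
by rewrite !spform_ei => /(congr1 ( *%R (sgn i))); rewrite !mulrA sgn_sqr !mul1r.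
Qed.

Lemma mx_ext (A B : 'M[R]_(2 * l)) :
  (forall w : 'cV[R]_(2 * l), A *m w = B *m w) -> A = B.
Proof.
move=> h; apply/matrixP => i j; have := h (e_ j).
by rewrite /e_ -!colE => /colP/(_ i); rewrite !mxE.
Qed.

Definition is_sp (g : 'M[R]_(2 * l)) : Prop :=
  (exists h, g *m h = 1%:M /\ h *m g = 1%:M) /\
  (forall u v, spform (g *m u) (g *m v) = spform u v).

Record Sp := MkSp { sp_mx :> 'M[R]_(2 * l); _ : `[< is_sp sp_mx >] }.

HB.instance Definition _ := [isSub for sp_mx].
HB.instance Definition _ := [Choice of Sp by <:].

Lemma sp_is_sp (g : Sp) : is_sp g.
Proof. by case: g => g /= /asboolP. Qed.

Lemma sp_form (g : Sp) u v : spform (g *m u) (g *m v) = spform u v.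
Proof. by case: (sp_is_sp g). Qed.

Lemma is_sp1 : is_sp 1%:M.
Proof.
by split=> [|u v]; [exists 1%:M; rewrite mulmx1 | rewrite !mul1mx].
Qed.

Lemma is_spM g h : is_sp g -> is_sp h -> is_sp (g *m h).
Proof.
move=> [[g' [g1 g2]] fg] [[h' [h1 h2]] fh]; split; last first.
  by move=> u v; rewrite -!mulmxA fg fh.
exists (h' *m g'); split.
  by rewrite mulmxA -[g *m h *m h']mulmxA h1 mulmx1.
by rewrite mulmxA -[h' *m g' *m g]mulmxA g2 mulmx1.
Qed.

Lemma is_sp_inv_ex (g : Sp) :
  exists h, `[< [/\ g *m h = 1%:M, h *m g = 1%:M & is_sp h] >].
Proof.
case: (sp_is_sp g) => -[h [gh hg]] fg; exists h; apply/asboolP; split=> //.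
split=> [|u v]; first by exists g.
by rewrite -fg !mulmxA gh !mul1mx.
Qed.

Definition sp_inv_mx (g : Sp) : 'M[R]_(2 * l) := xchoose (is_sp_inv_ex g).

Lemma sp_inv_mxP (g : Sp) :
  [/\ g *m sp_inv_mx g = 1%:M, sp_inv_mx g *m g = 1%:M & is_sp (sp_inv_mx g)].
Proof. exact/asboolP/(xchooseP (is_sp_inv_ex g)). Qed.

Definition sp_one : Sp := MkSp (asboolT is_sp1).
Definition sp_mul (g h : Sp) : Sp :=
  MkSp (asboolT (is_spM (sp_is_sp g) (sp_is_sp h))).
Definition sp_inv (g : Sp) : Sp := 
  MkSp (asboolT (let: And3 _ _ h := sp_inv_mxP g in h)).

Lemma sp_mulA : associative sp_mul.
Proof. by move=> x y z; apply/val_inj; rewrite /= mulmxA. Qed.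
Lemma sp_mul1 : left_id sp_one sp_mul.
Proof. by move=> x; apply/val_inj; rewrite /= mul1mx. Qed.
Lemma sp_mulx1 : right_id sp_one sp_mul.
Proof. by move=> x; apply/val_inj; rewrite /= mulmx1. Qed.
Lemma sp_mulV : left_inverse sp_one sp_inv sp_mul.
Proof. by move=> x; apply/val_inj; case: (sp_inv_mxP x). Qed.
Lemma sp_mulxV : right_inverse sp_one sp_inv sp_mul.
Proof. by move=> x; apply/val_inj; case: (sp_inv_mxP x). Qed.

HB.instance Definition _ :=
  isGroup.Build Sp sp_mulA sp_mul1 sp_mulx1 sp_mulV sp_mulxV.

Lemma sp_mxM (g h : Sp) : (g * h)%g = g *m h :> 'M[R]_(2 * l).
Proof. by []. Qed.

(* The matrix of w |-> w + u (<v,w> + a <u,w>) + v <u,w>; see mulTmx. *)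
Definition T (u v : 'cV[R]_(2 * l)) (a : R) : 'M[R]_(2 * l) :=
  1%:M + u *m (v^T *m gram + a *: (u^T *m gram)) + v *m (u^T *m gram).

Lemma Tcongr u v v' a a' : v = v' -> a = a' -> T u v a = T u v' a'.
Proof. by move=> -> ->. Qed.

Lemma mulTmx u v a w :
  T u v a *m w = w + (spform v w + a * spform u w) *: u + spform u w *: v.
Proof.
have E (x y : 'cV[R]_(2 * l)) : x *m (y^T *m gram) *m w = spform y w *: x.
  rewrite -mulmxA [y^T *m gram *m w]mx11_scalar -/(spform y w).
  by rewrite mul_mx_scalar.
by rewrite /T mulmxDr -scalemxAr !mulmxDl mul1mx -scalemxAl !E scalerDl scalerA.
Qed.

Lemma Tadd u v w a b : spform u v = 0 -> spform u w = 0 ->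
  T u v a *m T u w b = T u (v + w) (a + b + spform v w).
Proof.
move=> uv uw; apply: mx_ext => x; rewrite -mulmxA !mulTmx.
rewrite !(spformDl, spformDr, spformZl, spformZr) spform_alt uw (spform_skew u v) uv.
by apply/colP => i; rewrite !mxE; ring.
Qed.

Lemma T00 u : T u 0 0 = 1%:M.
Proof.
apply: mx_ext => w; rewrite mulTmx mul1mx spform0l.
by rewrite mul0r addr0 scale0r scaler0 !addr0.
Qed.

Lemma TVr u v a : spform u v = 0 -> T u v a *m T u (- v) (- a) = 1%:M.
Proof.
move=> uv; have uNv : spform u (- v) = 0 by rewrite -scaleN1r spformZr uv mulr0.
have vNv : spform v (- v) = 0 by rewrite -scaleN1r spformZr spform_alt mulr0.
by rewrite Tadd // vNv !subrr addr0 T00.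
Qed.

Lemma T_is_sp u v a : spform u v = 0 -> is_sp (T u v a).
Proof.
move=> uv; split.
  exists (T u (- v) (- a)); split; first exact: TVr.
  rewrite -{2}[v]opprK -{2}[a]opprK TVr // -scaleN1r spformZr uv mulr0 //.
move=> x y; rewrite !mulTmx !(spformDl, spformDr, spformZl, spformZr) !spform_alt uv.
rewrite (spform_skew u v) uv (spform_skew u x) (spform_skew v x); ring.
Qed.

Definition Tsp u v a (uv : spform u v = 0) : Sp :=
  MkSp (asboolT (T_is_sp a uv)).

Lemma Tconj (g : 'M[R]_(2 * l)) u v a :
  (forall x y, spform (g *m x) (g *m y) = spform x y) ->
  g *m T u v a = T (g *m u) (g *m v) a *m g.
Proof.
move=> fg; apply: mx_ext => w; rewrite -!mulmxA !mulTmx !fg.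
by rewrite !mulmxDr !scalemxAr.
Qed.

Lemma TC u v a : T u (a *: v) 0 = T v (a *: u) 0.
Proof.
apply: mx_ext => w; rewrite !mulTmx !spformZl !mul0r !addr0 !scalerA.
by rewrite addrAC [spform u w * a]mulrC [spform v w * a]mulrC.
Qed.

Lemma Tdbl u a : T u (a *: u) 0 = T u 0 (2 * a).
Proof.
apply: mx_ext => w; rewrite !mulTmx spform0l !spformZl.
by apply/colP => i; rewrite !mxE; ring.
Qed.

(* The elementary root element T_ij(a), long (j = -i) or short. *)
Definition Tel (i j : 'I_(2 * l)) (a : R) : 'M[R]_(2 * l) :=
  if j == rev_ord i then T (e_ i) 0 a
  else T (e_ i) ((a * sgn (rev_ord j)) *: e_ (rev_ord j)) 0.

Lemma spform_Tel i j c : i != j -> spform (e_ i) (c *: e_ (rev_ord j)) = 0.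
Proof. by move=> nij; rewrite spformZr spform_e rev_ordK (negbTE nij) mulr0. Qed.

Lemma Tel_is_sp i j a : i != j -> is_sp (Tel i j a).
Proof.
move=> nij; rewrite /Tel; case: ifP => _; apply: T_is_sp.
  exact: spform0r.
exact: spform_Tel.
Qed.

Definition elem_gen (g : Sp) : Prop :=
  exists i j a, i != j /\ g = Tel i j a :> 'M[R]_(2 * l).

Definition is_ep (g : Sp) : bool := `[< in_generated elem_gen g >].

Record Ep := MkEp { ep_sp :> Sp; _ : is_ep ep_sp }.

HB.instance Definition _ := [isSub for ep_sp].
HB.instance Definition _ := [Choice of Ep by <:].

Lemma is_ep_closed : group_closed is_ep.
Proof.
split=> [|x y /asboolP ex /asboolP ey]; first exact/asboolP/in_generated_one.
by apply/asboolP/in_generated_mul => //; exact: in_generated_inv.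
Qed.

HB.instance Definition _ := SubChoice_isSubGroup.Build Sp is_ep Ep is_ep_closed.

Lemma ep_spM (g h : Ep) : (g * h)%g = ((g : Sp) * (h : Sp))%g :> Sp.
Proof. exact: (valM g h). Qed.

Definition elem_col (u : 'cV[R]_(2 * l)) : Prop :=
  exists (g : Ep) (i : 'I_(2 * l)), u = g *m e_ i.

Lemma elem_col_e i : elem_col (e_ i).
Proof. by exists 1%g, i; rewrite mul1mx. Qed.

Local Notation "-% i" := (rev_ord i) (at level 35).

Definition St_gen := {x : 'I_(2 * l) * 'I_(2 * l) * R | x.1.1 != x.1.2}.
HB.instance Definition _ := Choice.on St_gen.

Definition st_gen (i j : 'I_(2 * l)) (a : R) (h : i != j) : St_gen :=
  exist _ (i, j, a) h.

Local Notation x_ i j a h := (wgen (@st_gen i j a h)).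

(* Each constructor is quantified over proofs that all the symbols occurring in
   it are defined, so it imposes nothing when one of them is not. *)
Inductive St_rel : word St_gen -> word St_gen -> Prop :=
| St_R0 i j a h h' :
    St_rel (x_ i j a h) (x_ (-% j) (-% i) (- (a * sgn i * sgn j)) h')
| St_R1 i j a b h :
    St_rel (x_ i j a h ++ x_ i j b h) (x_ i j (a + b) h)
| St_R2 i j h k a b hij hhk :
    h != j -> h != -% i -> k != i -> k != -% j ->
    St_rel (wcomm (x_ i j a hij) (x_ h k b hhk)) [::]
| St_R3 i j k a b hij hjk hik :
    i != -% j -> i != -% k -> j != -% k ->
    St_rel (wcomm (x_ i j a hij) (x_ j k b hjk)) (x_ i k (a * b) hik)
| St_R4 i j a b h1 h2 h3 h4 :
    St_rel (wcomm (x_ i (-% i) a h1) (x_ (-% i) j b h2))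
      (x_ i j (a * b * sgn i) h3 ++ x_ (-% j) j (- (a * b ^+ 2)) h4)
| St_R5 i j a b h1 h2 h3 :
    St_rel (wcomm (x_ i j a h1) (x_ j (-% i) b h2))
      (x_ i (-% i) (2 * a * b * sgn i) h3).

Definition StSp := presented St_rel.
HB.instance Definition _ := Group.on StSp.

Definition StX (i j : 'I_(2 * l)) (a : R) (h : i != j) : StSp :=
  pres_gen St_rel (st_gen a h).

Lemma Tel_is_ep i j a (h : i != j) : is_ep (MkSp (asboolT (Tel_is_sp a h))).
Proof. by apply/asboolP/in_generated_mem; exists i, j, a. Qed.

Definition Tep (i j : 'I_(2 * l)) (a : R) (h : i != j) : Ep :=
  MkEp (Tel_is_ep a h).

Lemma ep_inj (g h : Ep) : g = h :> 'M[R]_(2 * l) -> g = h.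
Proof. by move=> e; apply/val_inj/val_inj. Qed.

Lemma ep_mxM (g h : Ep) : (g * h)%g = g *m h :> 'M[R]_(2 * l).
Proof. by rewrite ep_spM. Qed.

Lemma rev_ord_eqC (i j : 'I_(2 * l)) : (i == -% j) = (j == -% i).
Proof. by rewrite -(inj_eq rev_ord_inj) rev_ordK eq_sym. Qed.

Lemma Tel_long i a : Tel i (-% i) a = T (e_ i) 0 a.
Proof. by rewrite /Tel eqxx. Qed.

Lemma Tel_longN j a : Tel (-% j) j a = T (e_ (-% j)) 0 a.
Proof. by rewrite /Tel rev_ordK eqxx. Qed.

Lemma Tel_short i j a : j != -% i ->
  Tel i j a = T (e_ i) ((a * sgn (-% j)) *: e_ (-% j)) 0.
Proof. by rewrite /Tel => /negbTE ->. Qed.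

Lemma Tel_R0 i j a : Tel i j a = Tel (-% j) (-% i) (- (a * sgn i * sgn j)).
Proof.
have [->|nj] := eqVneq j (-% i).
  by rewrite rev_ordK !Tel_long sgn_rev mulrN opprK -mulrA sgn_sqr mulr1.
rewrite Tel_short // Tel_short; last by rewrite rev_ordK eq_sym.
rewrite rev_ordK TC; apply: Tcongr => //; congr (_ *: _); rewrite sgn_rev.
by transitivity (- (a * sgn j) * (sgn i * sgn i)); [rewrite sgn_sqr|]; ring.
Qed.

Lemma Tel_R1 i j a b : i != j -> Tel i j a *m Tel i j b = Tel i j (a + b).
Proof.
move=> nij; have [->|nj] := eqVneq j (-% i).
  by rewrite !Tel_long Tadd ?spform0r // !addr0.
rewrite !Tel_short // Tadd ?spform_Tel // spformZl spformZr spform_alt.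
by rewrite !mulr0 !addr0 -scalerDl -mulrDl.
Qed.

Lemma Tel_form i j a : i != j ->
  forall x y, spform (Tel i j a *m x) (Tel i j a *m y) = spform x y.
Proof. by move=> nij; case: (Tel_is_sp a nij). Qed.

Lemma Tel_e i j a k : k != j -> k != -% i -> Tel i j a *m e_ k = e_ k.
Proof.
move=> kj ki; have f1 : spform (e_ i) (e_ k) = 0.
  by rewrite spform_e rev_ord_eqC (negbTE ki).
have f2 : spform (e_ (-% j)) (e_ k) = 0.
  by rewrite spform_e (inj_eq rev_ord_inj) eq_sym (negbTE kj).
rewrite /Tel; case: ifP => _; rewrite mulTmx ?spformZl ?spform0l f1 ?f2.
  by rewrite mulr0 addr0 !scale0r !addr0.
by rewrite !mulr0 addr0 !scale0r !addr0.
Qed.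

Lemma Tel_ej i j a : i != j -> j != -% i -> Tel i j a *m e_ j = e_ j + a *: e_ i.
Proof.
move=> nij nj; have f1 : spform (e_ i) (e_ j) = 0.
  by rewrite spform_e rev_ord_eqC (negbTE nj).
rewrite Tel_short // mulTmx spformZl f1 spform_e eqxx -mulrA sgn_sqr.
by rewrite !mulr1 mul0r addr0 scale0r addr0.
Qed.

Lemma Tel_R2 i j h k a b : i != j ->
  h != j -> h != -% i -> k != i -> k != -% j ->
  Tel i j a *m Tel h k b = Tel h k b *m Tel i j a.
Proof.
move=> nij hj hi ki kj; have kh : Tel i j a *m e_ (-% k) = e_ (-% k).
  rewrite Tel_e // ?(inj_eq rev_ord_inj) //.
  by rewrite eq_sym rev_ord_eqC.
rewrite {2 3}/Tel; case: ifP => _; rewrite Tconj ?Tel_e ?mulmx0 //;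
  try exact: Tel_form.
by rewrite -scalemxAr kh.
Qed.

Lemma Tel_R3 i j k a b : i != j -> j != k -> i != k ->
    i != -% j -> i != -% k -> j != -% k ->
  Tel i j a *m Tel j k b = Tel i k (a * b) *m (Tel j k b *m Tel i j a).
Proof.
move=> nij njk nik ij ik jk.
have ji : j != -% i by rewrite rev_ord_eqC.
have ki : k != -% i by rewrite rev_ord_eqC.
have kj : k != -% j by rewrite rev_ord_eqC.
rewrite [Tel j k b]Tel_short // Tconj; last exact: Tel_form.
rewrite -scalemxAr Tel_ej // Tel_e; first last.
- by rewrite (inj_eq rev_ord_inj) eq_sym.
- by rewrite eq_sym.
rewrite mulmxA; congr (_ *m _).
rewrite Tel_short // !(TC _ (e_ (-% k))) Tadd ?spformZr ?spform_e.
- rewrite spformZl spform_e (negbTE ij) !mulr0 !addr0 scalerDr scalerA addrC.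
  by apply: Tcongr => //; congr (_ *: _ + _); ring.
- by rewrite (inj_eq rev_ord_inj) eq_sym (negbTE nik) mulr0.
- by rewrite (inj_eq rev_ord_inj) eq_sym (negbTE njk) mulr0.
Qed.

Lemma Tel_R4 i j a b : i != j -> -% i != j ->
  Tel i (-% i) a *m Tel (-% i) j b =
  Tel i j (a * b * sgn i) *m Tel (-% j) j (- (a * b ^+ 2)) *m
    (Tel (-% i) j b *m Tel i (-% i) a).
Proof.
move=> nij nj; have ii : i != -% i by rewrite eq_sym rev_ord_neq.
have ji : j != -% i by rewrite eq_sym.
have jii : j != -% -% i by rewrite rev_ordK eq_sym.
rewrite [Tel (-% i) j b]Tel_short // Tconj; last exact: Tel_form.
have ji' : -% j != -% i by rewrite (inj_eq rev_ord_inj) eq_sym.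
rewrite -scalemxAr [_ *m e_ (-% j)]Tel_e //.
rewrite mulmxA; congr (_ *m _).
rewrite Tel_long mulTmx spform0l add0r spform_e rev_ordK eqxx scaler0 addr0.
rewrite Tel_longN Tel_short // !(TC _ (e_ (-% j))).
have fi : spform (e_ (-% j)) (e_ i) = 0.
  by rewrite spform_e (inj_eq rev_ord_inj) eq_sym (negbTE nij).
have fi' : spform (e_ (-% j)) (e_ (-% i)) = 0.
  by rewrite spform_e (inj_eq rev_ord_inj) (negbTE ji).
rewrite !Tadd ?spform0r ?spformZr ?fi ?fi' ?mulr0 // ?addr0; first last.
- by rewrite spformZr fi mulr0.
rewrite spformZl spform_e rev_ordK eqxx.
apply: Tcongr; first by rewrite scalerDr scalerA addrC; congr (_ *: _ + _); ring.
transitivity (a * b ^+ 2 * ((sgn i * sgn i) * (sgn (-% j) * sgn (-% j)) - 1)).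
  by rewrite !sgn_sqr mul1r subrr mulr0.
ring.
Qed.

Lemma Tel_R5 i j a b : i != j -> j != -% i ->
  Tel i j a *m Tel j (-% i) b =
  Tel i (-% i) (2 * a * b * sgn i) *m (Tel j (-% i) b *m Tel i j a).
Proof.
move=> nij nj; have ni : -% i != -% j by rewrite (inj_eq rev_ord_inj).
have fij : spform (e_ i) (e_ j) = 0 by rewrite spform_e rev_ord_eqC (negbTE nj).
have fji : spform (e_ j) (e_ i) = 0 by rewrite spform_skew fij oppr0.
rewrite [Tel j _ b]Tel_short // Tconj; last exact: Tel_form.
have ii : i != -% i by rewrite eq_sym rev_ord_neq.
rewrite rev_ordK -scalemxAr Tel_ej // Tel_e //.
rewrite mulmxA; congr (_ *m _).
rewrite Tel_long !(TC _ (e_ i)).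
have -> : T (e_ i) 0 (2 * a * b * sgn i) =
          T (e_ i) ((a * b * sgn i) *: e_ i) 0.
  by rewrite Tdbl; apply: Tcongr => //; rewrite !mulrA.
rewrite Tadd ?spformZr ?spformZl ?fij ?spform_alt ?mulr0 // ?addr0.
apply: Tcongr => //.
by rewrite scalerDr scalerA addrC; congr (_ *: _ + _); ring.
Qed.

Section Commutator.
Local Open Scope group_scope.

Lemma weval_comm (G : choiceType) (H : groupType) (f : G -> H) (x y : G) :
  weval f (wcomm (wgen x) (wgen y)) = f x * f y * (f x)^-1 * (f y)^-1.
Proof. by rewrite /= mulg1 !mulgA. Qed.

Lemma comm_eq (H : groupType) (x y z : H) :
  x * y = z * (y * x) -> x * y * x^-1 * y^-1 = z.
Proof. by move=> ->; rewrite mulgA mulgK mulgK. Qed.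

End Commutator.

Definition St_gen_Ep (x : St_gen) : Ep := Tep (val x).2 (valP x).

Lemma St_gen_EpE i j a (h : i != j) :
  St_gen_Ep (st_gen a h) = Tel i j a :> 'M[R]_(2 * l).
Proof. by []. Qed.

Lemma St_gen_Ep_rel w1 w2 :
  St_rel w1 w2 -> weval St_gen_Ep w1 = weval St_gen_Ep w2.
Proof.
case=> {w1 w2}.
- move=> i j a h h'; rewrite !weval_gen; apply: ep_inj.
  by rewrite !St_gen_EpE Tel_R0.
- move=> i j a b h; rewrite weval_cat !weval_gen; apply: ep_inj.
  by rewrite ep_mxM !St_gen_EpE Tel_R1.
- move=> i j h k a b hij hhk hj hi ki kj; rewrite weval_comm.
  apply: comm_eq; apply: ep_inj.
  by rewrite !ep_mxM !St_gen_EpE mul1mx Tel_R2.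
- move=> i j k a b hij hjk hik ij ik jk; rewrite weval_comm weval_gen.
  apply: comm_eq; apply: ep_inj.
  by rewrite !ep_mxM !St_gen_EpE Tel_R3.
- move=> i j a b h1 h2 h3 h4; rewrite weval_comm weval_cat !weval_gen.
  apply: comm_eq; apply: ep_inj.
  by rewrite !ep_mxM !St_gen_EpE Tel_R4.
- move=> i j a b h1 h2 h3; rewrite weval_comm weval_gen.
  apply: comm_eq; apply: ep_inj.
  rewrite !ep_mxM !St_gen_EpE Tel_R5 //.
Qed.

Definition phi : {multiplicative StSp -> Ep} := pres_lift St_gen_Ep_rel.

Lemma phi_StX i j a (h : i != j) : phi (StX a h) = Tep a h.
Proof. by rewrite [phi _]pres_lift_gen; exact: ep_inj. Qed.

Lemma phi_surj (g : Ep) : exists x, phi x = g.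
Proof.
have phi1 : phi 1%g = 1%g by apply: (mulgI (phi 1%g)); rewrite -gmulfM !mulg1.
suff H : forall g' : Sp, in_generated elem_gen g' -> exists x, phi x = g' :> Sp.
  by case: g => g gE; case: (H g (asboolW gE)) => x ex; exists x; apply/val_inj.
move=> {}g; elim=> {g} [g [i [j [a [h eg]]]] | | g h _ [x <-] _ [y <-] | g _ [x <-]].
- by exists (StX a h); rewrite phi_StX; apply/val_inj.
- by exists 1%g; rewrite phi1.
- by exists (x * y)%g; rewrite gmulfM ep_spM.
- exists x^-1%g; apply: (mulgI (phi x : Sp)).
  by rewrite -ep_spM -gmulfM !mulgV phi1.
Qed.

Definition vdk_ok (u v : 'cV[R]_(2 * l)) : Prop :=
  elem_col u /\ spform u v = 0.

Definition Vdk_gen :=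
  {x : 'cV[R]_(2 * l) * 'cV[R]_(2 * l) * R | `[< vdk_ok x.1.1 x.1.2 >]}.
HB.instance Definition _ := Choice.on Vdk_gen.

Definition vdk_gen (u v : 'cV[R]_(2 * l)) (a : R) (h : vdk_ok u v) : Vdk_gen :=
  exist _ (u, v, a) (asboolT h).

Local Notation y_ u v a h := (wgen (@vdk_gen u v a h)).

Inductive Vdk_rel : word Vdk_gen -> word Vdk_gen -> Prop :=
| Vdk_P1 u v w a b hv hw hvw :
    Vdk_rel (y_ u v a hv ++ y_ u w b hw)
      (y_ u (v + w) (a + b + spform v w) hvw)
| Vdk_P2 u v a hu hv : spform u v = 0 ->
    Vdk_rel (y_ u (a *: v) 0 hu) (y_ v (a *: u) 0 hv)
| Vdk_P3 u v a u' v' b h h' hT :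
    Vdk_rel (y_ u' v' b h' ++ y_ u v a h ++ winv (y_ u' v' b h'))
      (y_ (T u' v' b *m u) (T u' v' b *m v) a hT).

Definition VdkSp := presented Vdk_rel.
HB.instance Definition _ := Group.on VdkSp.

Definition VdkX (u v : 'cV[R]_(2 * l)) (a : R) (h : vdk_ok u v) : VdkSp :=
  pres_gen Vdk_rel (vdk_gen a h).

Lemma vdk_ok0 u : elem_col u -> vdk_ok u 0.
Proof. by move=> uc; split=> //; exact: spform0r. Qed.

Lemma vdk_okZ u v a : elem_col u -> spform u v = 0 -> vdk_ok u (a *: v).
Proof. by move=> uc uv; split=> //; rewrite spformZr uv mulr0. Qed.

Lemma vdk_okZC u v a : elem_col v -> spform u v = 0 -> vdk_ok v (a *: u).
Proof. by move=> vc uv; apply: vdk_okZ => //; rewrite spform_skew uv oppr0. Qed.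

Lemma vdk_ok_e i j a : i != j ->
  vdk_ok (e_ i) ((a * sgn (-% j)) *: e_ (-% j)).
Proof. by move=> nij; split; [exact: elem_col_e | exact: spform_Tel]. Qed.

End Symplectic.

Arguments sgn {R l} i.
Arguments e_ {R l} i.
Arguments StX {R l} i j a h.
Arguments VdkX {R l} u v a h.

(* Main.v *)
Require Import Defs.
From HB Require Import structures.
From mathcomp Require Import all_boot all_order all_algebra.
From mathcomp Require Import boolp ring zify.

Set Implicit Arguments.
Unset Strict Implicit.
Unset Printing Implicit Defensive.

Import GRing.Theory.
Local Open Scope ring_scope.

(** Why the two presentations agree.

    The maps T(u,v,a) satisfy P1-P6, so the issue is to lift them to StSp in
    such a way that conjugation by g acts on the arguments through phi(g).
    The idea is to lift the long root elements T(u,0,a) first, and to do it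
    for every vector u of V, with no condition on u: the elements [longX u a]
    satisfy g (longX u a) g^-1 = longX (phi(g) u) a for all g in StSp
    ([longX_cj]).  In particular the kernel of phi centralises them, hence is
    central.  The identity
      T(u+v,0,a) = T(u,0,a) T(v,0,a) T(u,va,0)   for <u,v> = 0
    then dictates the lift [stT u v a] of T(u,v,a), which is equivariant
    because long root elements are.  By equivariance a relation for a column
    u = g e_i needs to be checked only for u = e_i, where stT (e_i) v a is
    the element [xU i v a] of the unipotent radical U_i of the stabiliser of
    e_i ([stT_e]), and the relations are visible.

    Construction of longX.  Let H_k be the span of e_k and e_-k.
    - For w orthogonal to H_k, conjugating the long root element of e_k by the
      shear e_k -> e_k + w lifts T(e_k + w,0,a); stripping off the factors
      T(e_k,0,a) and T(e_k,wa,0) leaves the lift [longT k w a] of T(w,0,a).  It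
      is equivariant under the elements acting correctly on U_k and U_-k.
    - Writing u = y + w with y in H_k and w orthogonal to H_k, T(u,0,a) is the
      product of T(y,0,a), T(w,0,a) and the short element T(w,ya,0), which is
      itself a product of elements of U_k, U_-k and a long root element
      ([shortT]).  This gives the lift [longT_split] of T(u,0,a), equivariant
      under all generators X_pq whose indices avoid k and -k.
    - As l >= 3, every generator avoids some pair k, -k, so equivariance under
      all of StSp follows once the lift is independent of k
      ([split_indep]).

    Independence of k rests on one computation, [shear_xU_hyp]: for y in H_j
    and z orthogonal to H_j and H_k, the commutator of the shear along z with
    x_k(y) is the short element shortT of z and y.  Computing longT k (y + z)
    by shearing along y and z in either order, it yields the factorisation of
    longT, and comparing the two orders yields the scaling rule
    [shortT_scale] and the symmetry [shortT_sym] of short elements.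

    Conversely, R0-R5 follow from P1-P3, whence a map back from StSp to the
    group of the second presentation.  It intertwines the conjugation actions
    ([st_to_vdk_cj]), so both composites are the identity on generators.
    Finally P4-P6 hold in StSp by the same reduction to u = e_i. *)

(** * Presented groups *)
Section PresentedGroups.
Local Open Scope group_scope.
Variables (A : choiceType) (rel : word A -> word A -> Prop).

Lemma pi_pres_weval (w : word A) : pi_pres rel w = weval (pres_gen rel) w.
Proof.
have pi1 : pi_pres rel [::] = 1 by [].
elim: w => [//|[x b] w IHw]; rewrite -cat1s pi_presM IHw /=; congr (_ * _).
case: b => //; apply: (mulgI (pres_gen rel x)); rewrite mulgV.
by rewrite -pi_presM -pi1; apply/pi_presP; exact: (pres_cancel rel x false).
Qed.

Lemma pres_gen_rel (w1 w2 : word A) :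
  rel w1 w2 -> weval (pres_gen rel) w1 = weval (pres_gen rel) w2.
Proof. by move=> r; rewrite -!pi_pres_weval; exact/pi_presP/pres_rel. Qed.

Lemma presented_ind (Q : presented rel -> Prop) :
    Q 1 -> (forall x y, Q x -> Q y -> Q (x * y)) -> (forall x, Q x -> Q x^-1) ->
    (forall x, Q (pres_gen rel x)) -> forall g, Q g.
Proof.
move=> Q1 QM QV Qgen g; rewrite -[g]pi_presK pi_pres_weval.
elim: (repr g) => [//|[x b] w IHw] /=; apply: QM => //.
by case: b => //; exact: QV.
Qed.

End PresentedGroups.

(** Products in a presented group unfold to words; the elements built below
    are locked with this key so that rewriting does not unfold them. *)
Fact steinberg_key : unit. Proof. exact: tt. Qed.

Section GroupLemmas.
Local Open Scope group_scope.
Variable H : groupType.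
Implicit Types g h x y z : H.

Lemma comm_slide g x y : g * x * g^-1 * x^-1 = y -> g * x = y * (x * g).
Proof. by move=> <-; rewrite mulgA !mulgVK. Qed.

Lemma slideV g x y : g * x = y * g -> g^-1 * y = x * g^-1.
Proof. by move=> e; apply: (mulgI g); rewrite mulVKg mulgA e mulgK. Qed.

Lemma multiplicative1 (K : groupType) (f : {multiplicative H -> K}) : f 1 = 1.
Proof. by apply: (mulgI (f 1)); rewrite -gmulfM !mulg1. Qed.

Lemma multiplicativeV (K : groupType) (f : {multiplicative H -> K}) x :
  f x^-1 = (f x)^-1.
Proof. by apply: (mulgI (f x)); rewrite -gmulfM !mulgV multiplicative1. Qed.

End GroupLemmas.

(** * The Steinberg relations as equations *)
Section Steinberg.
Variables (R : comPzRingType) (l : nat).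
Local Notation I := 'I_(2 * l).
Local Notation V := 'cV[R]_(2 * l).
Local Notation G := (StSp R l).
Local Notation "-% i" := (rev_ord i) (at level 35).
Implicit Types (i j k : I) (u v w : V) (a b c : R) (g : G).

(** The generator X_ij(a), extended by 1 to i = j, so that relations can be
    rewritten with without carrying proofs of i != j. *)
Definition stX i j a : G :=
  match boolP (i != j) with AltTrue h => StX i j a h | AltFalse _ => 1%g end.

Lemma stXE i j a (h : i != j) : stX i j a = StX i j a h.
Proof.
rewrite /stX; case: {-}_ / boolP => [h'|]; last by rewrite h.
by congr (StX _ _ _ _); exact: bool_irrelevance.
Qed.

Lemma stXii i a : stX i i a = 1%g.
Proof. by rewrite /stX; case: {-}_ / boolP => // nii; have := nii; rewrite eqxx. Qed.

Lemma StSp_ind (Q : G -> Prop) :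
    Q 1%g -> (forall x y, Q x -> Q y -> Q (x * y)%g) ->
    (forall x, Q x -> Q x^-1%g) ->
    (forall i j a, i != j -> Q (stX i j a)) -> forall g, Q g.
Proof.
move=> Q1 QM QV QX; apply: presented_ind => // -[[[i j] a] /= h].
by have := QX i j a h; rewrite (stXE a h).
Qed.

Lemma rev_ord_neqC i : i != -% i.
Proof. by rewrite eq_sym rev_ord_neq. Qed.

Lemma stX_R0 i j a : stX i j a = stX (-% j) (-% i) (- (a * sgn i * sgn j)).
Proof.
have [<-|nij] := eqVneq i j; first by rewrite !stXii.
have nji : -% j != -% i by rewrite (inj_eq rev_ord_inj) eq_sym.
by rewrite !stXE; have := pres_gen_rel (St_R0 a nij nji); rewrite !weval_gen.
Qed.

Lemma stX_R1 i j a b : (stX i j a * stX i j b)%g = stX i j (a + b).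
Proof.
have [<-|nij] := eqVneq i j; first by rewrite !stXii mulg1.
by rewrite !stXE; have := pres_gen_rel (St_R1 a b nij); rewrite weval_cat !weval_gen.
Qed.

Lemma stX_R2 i j (h : I) k a b : h != j -> h != -% i -> k != i -> k != -% j ->
  (stX i j a * stX h k b = stX h k b * stX i j a)%g.
Proof.
have [<-|nij] := eqVneq i j; first by rewrite !stXii mulg1 mul1g.
have [<-|nhk] := eqVneq h k; first by rewrite !stXii mulg1 mul1g.
move=> c1 c2 c3 c4; rewrite !stXE.
have := pres_gen_rel (St_R2 a b nij nhk c1 c2 c3 c4); rewrite weval_comm.
by move/comm_slide; rewrite mul1g.
Qed.

Lemma stX_R3 i j k a b : i != j -> j != k -> i != k ->
    i != -% j -> i != -% k -> j != -% k ->
  (stX i j a * stX j k b = stX i k (a * b) * (stX j k b * stX i j a))%g.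
Proof.
move=> nij njk nik c1 c2 c3; rewrite !stXE; apply: comm_slide.
have := pres_gen_rel (St_R3 a b nij njk nik c1 c2 c3).
by rewrite weval_comm weval_gen.
Qed.

Lemma stX_R4 i j a b : i != j -> -% i != j ->
  (stX i (-% i) a * stX (-% i) j b = stX i j (a * b * sgn i) *
     stX (-% j) j (- (a * b ^+ 2)) * (stX (-% i) j b * stX i (-% i) a))%g.
Proof.
move=> nij nj; have ii := rev_ord_neqC i.
have jj : -% j != j by exact: rev_ord_neq.
rewrite !stXE; apply: comm_slide.
have := pres_gen_rel (St_R4 a b ii nj nij jj).
by rewrite weval_comm weval_cat !weval_gen.
Qed.

Lemma stX_R5 i j a b : i != j -> j != -% i ->
  (stX i j a * stX j (-% i) b =
   stX i (-% i) (2 * a * b * sgn i) * (stX j (-% i) b * stX i j a))%g.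
Proof.
move=> nij nj; have ii := rev_ord_neqC i.
rewrite !stXE; apply: comm_slide.
have := pres_gen_rel (St_R5 a b nij nj ii).
by rewrite weval_comm !weval_gen.
Qed.

Lemma stX0 i j : stX i j 0 = 1%g.
Proof. by apply: (mulgI (stX i j 0)); rewrite stX_R1 addr0 mulg1. Qed.

Definition rho g : 'M[R]_(2 * l) := phi R l g.

Lemma rhoM g g' : rho (g * g')%g = rho g *m rho g'.
Proof. by rewrite /rho gmulfM ep_mxM. Qed.

Lemma rho1 : rho 1%g = 1%:M.
Proof. by rewrite /rho multiplicative1. Qed.

Lemma rhoK g : rho g *m rho g^-1%g = 1%:M.
Proof. by rewrite -rhoM mulgV rho1. Qed.

Lemma rhoVK g : rho g^-1%g *m rho g = 1%:M.
Proof. by rewrite -rhoM mulVg rho1. Qed.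

Lemma rho_form g u v : spform (rho g *m u) (rho g *m v) = spform u v.
Proof. exact: sp_form. Qed.

Lemma rho_stX i j a : i != j -> rho (stX i j a) = Tel i j a.
Proof. by move=> h; rewrite (stXE a h) /rho phi_StX. Qed.

Lemma rho_elem g i : elem_col (rho g *m e_ i).
Proof. by exists (phi R l g), i. Qed.

(** phi is onto, so a column of an elementary matrix is a translate of a basis
    vector by an element of the Steinberg group itself. *)
Lemma elem_colP u : elem_col u -> exists g i, u = rho g *m e_ i.
Proof.
by case=> g [i ->]; have [x <-] := phi_surj g; exists x, i.
Qed.

Lemma elem_col_rho g u : elem_col u -> elem_col (rho g *m u).
Proof.
by move=> /elem_colP[h [i ->]]; rewrite mulmxA -rhoM; exact: rho_elem.
Qed.

End Steinberg.

(** * The unipotent radical of the stabiliser of e_i *)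
Section Unipotent.
Variables (R : comPzRingType) (l : nat).
Local Notation I := 'I_(2 * l).
Local Notation V := 'cV[R]_(2 * l).
Local Notation G := (StSp R l).
Local Notation "-% i" := (rev_ord i) (at level 35).
Implicit Types (i j k : I) (u v w : V) (a b c : R) (g : G) (s : seq I).

Lemma spform_ei w i : spform (e_ (-% i)) w = - sgn i * w i 0.
Proof.
rewrite spformE (bigD1 (-% i)) //= big1 ?addr0 => [|k nk].
  by rewrite mxE !eqxx mul1r rev_ordK sgn_rev.
by rewrite mxE (negbTE nk) mul0r mulr0.
Qed.

Lemma coordE w i : w i 0 = - sgn i * spform (e_ (-% i)) w.
Proof. by rewrite spform_ei mulrA mulrNN sgn_sqr mul1r. Qed.

Lemma spform_e0 i j : j != -% i -> spform (R := R) (e_ i) (e_ j) = 0.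
Proof. by move=> h; rewrite spform_e rev_ord_eqC (negbTE h). Qed.

Lemma spform_ee i : spform (R := R) (e_ i) (e_ (-% i)) = sgn i.
Proof. by rewrite spform_e rev_ordK eqxx. Qed.

(** X(e_i, e_k c, 0) in terms of the generators.  Including k = i, where it is
    X(e_i, 0, 2c), makes X(e_i, v, a) defined for all v orthogonal to e_i and
    builds P4 into the definition. *)
Definition xgen i k c : G :=
  if k == i then stX i (-% i) (2 * c) else stX i (-% k) (c * sgn k).

Definition zgen i a : G := stX i (-% i) a.

Lemma zgenD i a b : (zgen i a * zgen i b)%g = zgen i (a + b).
Proof. exact: stX_R1. Qed.

Lemma zgen0 i : zgen i 0 = 1%g.
Proof. exact: stX0. Qed.

Lemma xgen_ii i c : xgen i i c = zgen i (2 * c).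
Proof. by rewrite /xgen eqxx. Qed.

Lemma xgenD i k c d : (xgen i k c * xgen i k d)%g = xgen i k (c + d).
Proof. by rewrite /xgen; case: ifP => _; rewrite stX_R1; congr stX; ring. Qed.

Lemma xgen0 i k : xgen i k 0 = 1%g.
Proof. by apply: (mulgI (xgen i k 0)); rewrite xgenD addr0 mulg1. Qed.

Lemma zgen_xgen i k a c : k != -% i -> (zgen i a * xgen i k c = xgen i k c * zgen i a)%g.
Proof.
move=> ki; rewrite /zgen /xgen; case: ifP => [_|/negbT nki].
  by rewrite !stX_R1 addrC.
apply: stX_R2; rewrite ?rev_ord_neqC ?(inj_eq rev_ord_inj) //.
by rewrite eq_sym rev_ord_eqC.
Qed.

(** U_i is a Heisenberg group: its generators commute up to a central element
    given by the symplectic form.  Only k = -j contributes, by R5. *)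
Lemma xgen_comm i j k c d : j != -% i -> k != -% i ->
  (xgen i j c * xgen i k d =
   xgen i k d * xgen i j c * zgen i (2 * spform (e_ j) (e_ k) * c * d))%g.
Proof.
move=> ji ki; have [->|nji] := eqVneq j i.
  rewrite spform_e0 // mulr0 !mul0r zgen0 mulg1.
  by rewrite xgen_ii zgen_xgen.
have [->|nki] := eqVneq k i.
  rewrite spform_e (negbTE ji).
  by rewrite mulr0 !mul0r zgen0 mulg1 xgen_ii zgen_xgen.
have [kj|nkj] := eqVneq k (-% j); last first.
  rewrite spform_e0 // mulr0 !mul0r zgen0 mulg1 /xgen (negbTE nji) (negbTE nki).
  apply: stX_R2; rewrite ?rev_ord_neqC ?rev_ordK ?(inj_eq rev_ord_inj) //.
  - by rewrite rev_ord_eqC.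
  - by rewrite eq_sym rev_ord_eqC.
  - by rewrite eq_sym rev_ord_eqC.
rewrite -mulgA -zgen_xgen // mulgA -zgen_xgen // -mulgA.
rewrite kj spform_ee /xgen -kj (negbTE nji) (negbTE nki) kj rev_ordK.
rewrite [stX i j _]stX_R0 stX_R5; first last.
- by rewrite (inj_eq rev_ord_inj).
- by rewrite rev_ord_eqC.
congr (stX _ _ _ * _)%g; rewrite sgn_rev.
transitivity (2 * sgn j * c * d * (sgn i * sgn i) * (sgn j * sgn j)).
  by ring.
by rewrite !sgn_sqr !mulr1.
Qed.

(** The form <v, e_k> with v cut down to its coordinates in s. *)
Definition pairing s v k : R := \sum_(j <- s) v j 0 * spform (e_ j) (e_ k).

(** By P1 the product of the X(e_i, e_j v_j, 0), j in s, is X(e_i, v, d) with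
    d the sum of the <e_j, e_m> v_j v_m over j preceding m in s. *)
Fixpoint defect s v : R :=
  if s is j :: s' then defect s' v - v j 0 * pairing s' v j else 0.

Fixpoint xprod i s v : G :=
  if s is j :: s' then (xgen i j (v j 0) * xprod i s' v)%g else 1%g.

Lemma xprod_xgen i s v k b : all (fun j => j != -% i) s -> k != -% i ->
  (xprod i s v * xgen i k b = xgen i k b * xprod i s v * zgen i (2 * pairing s v k * b))%g.
Proof.
move=> + ki; elim: s => [_|j s IHs] /=.
  by rewrite /pairing big_nil mulr0 mul0r zgen0 mul1g !mulg1.
case/andP=> ji si; rewrite -mulgA IHs // !mulgA xgen_comm // /pairing big_cons.
suff zp a : (zgen i a * xprod i s v = xprod i s v * zgen i a)%g.
  rewrite -!mulgA (mulgA (zgen _ _)) zp -!mulgA zgenD; do 3 congr (_ * _)%g.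
  by congr zgen; ring.
elim: s {IHs} si => [_|m s IHs] /=; first by rewrite mulg1 mul1g.
by case/andP=> mi si; rewrite mulgA zgen_xgen // -!mulgA IHs.
Qed.

Lemma pairing_add s v k b j : uniq s -> k \in s ->
  pairing s (v + b *: e_ k) j = pairing s v j + b * spform (e_ k) (e_ j).
Proof.
move=> us ks; rewrite /pairing.
under eq_bigr => m _ do rewrite !mxE mulrDl.
rewrite big_split /=; congr (_ + _); rewrite (big_rem k) //= big_seq big1.
  by rewrite !eqxx mulr1 addr0.
move=> m; rewrite mem_rem_uniq // inE => /andP[/negbTE -> _].
by rewrite mulr0 mul0r.
Qed.

Lemma pairing_notin s v k b j : k \notin s -> pairing s (v + b *: e_ k) j = pairing s v j.
Proof.
move=> ks; rewrite /pairing; apply: eq_big_seq => m ms; rewrite !mxE.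
have /negbTE -> : m != k by apply: contraNneq ks => <-.
by rewrite mulr0 addr0.
Qed.

Lemma defect_notin s v k b : k \notin s -> defect s (v + b *: e_ k) = defect s v.
Proof.
elim: s => //= j s IHs; rewrite inE negb_or => /andP[kj ks].
by rewrite IHs // pairing_notin // !mxE (negbTE (_ : j != k)) 1?eq_sym // mulr0 addr0.
Qed.

Lemma xprod_notin i s v k b : k \notin s -> xprod i s (v + b *: e_ k) = xprod i s v.
Proof.
elim: s => //= j s IHs; rewrite inE negb_or => /andP[kj ks].
by rewrite IHs // !mxE (negbTE (_ : j != k)) 1?eq_sym // mulr0 addr0.
Qed.

(** The multiplication law of U_i for a second factor that is a generator.
    When k is the head of s the generator has to cross the tail, which costs
    twice the pairing; otherwise it reaches its place by induction. *)
Lemma xprod_step i s v k b a : uniq s -> all (fun j => j != -% i) s -> k \in s ->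
  (xprod i s v * zgen i (a - defect s v) * xgen i k b =
   xprod i s (v + b *: e_ k) * zgen i (a + pairing s v k * b - defect s (v + b *: e_ k)))%g.
Proof.
move=> us si ks; have ki : k != -% i by exact: (allP si).
rewrite -mulgA zgen_xgen //.
elim: s a us si ks => [//|j s IHs] a /= /andP[js us] /andP[ji si].
rewrite inE => /predU1P[kj|ks]; last first.
  have nkj : j != k by apply: contraNneq js => ->.
  rewrite !mxE (negbTE nkj) /= mulr0 addr0 -!mulgA; congr (_ * _)%g.
  have -> : a - (defect s v - v j 0 * pairing s v j) = a + v j 0 * pairing s v j - defect s v.
    by ring.
  rewrite IHs //; congr (_ * zgen _ _)%g.
  rewrite pairing_add // [pairing (_ :: _) _ _]/pairing big_cons -/(pairing _ _ _).
  by rewrite [spform (e_ k) _]spform_skew; ring.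
rewrite -{j}kj in js ji *; rewrite xprod_notin // defect_notin // pairing_notin // !mxE !eqxx.
rewrite -mulgA [(xprod _ _ _ * _)%g]mulgA xprod_xgen // !mulgA xgenD mulr1 -!mulgA zgenD.
do 2 congr (_ * _)%g; congr zgen.
rewrite [pairing (_ :: _) _ _]/pairing big_cons -/(pairing _ _ _) spform_alt.
by ring.
Qed.

Definition perp_idx i : seq I := [seq j <- enum 'I_(2 * l) | j != -% i].

(** X(e_i, v, a), for v orthogonal to e_i. *)
Definition xU : I -> V -> R -> G := locked_with steinberg_key
  (fun i v a => xprod i (perp_idx i) v * zgen i (a - defect (perp_idx i) v))%g.

Lemma xU_def i v a :
  xU i v a = (xprod i (perp_idx i) v * zgen i (a - defect (perp_idx i) v))%g.
Proof. by rewrite /xU unlock. Qed.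

Lemma pairing_perp i v k : spform (e_ i) v = 0 -> pairing (perp_idx i) v k = spform v (e_ k).
Proof.
rewrite /pairing big_filter big_enum_cond /= => vi.
have {2}-> : v = \sum_j v j 0 *: e_ j.
  by rewrite {1}[v]matrix_sum_delta; apply: eq_bigr => j _; rewrite big_ord1.
rewrite [in RHS](bigD1 (-% i)) //= spformDl spformZl coordE rev_ordK vi mulr0 mul0r add0r.
elim/big_rec2: _ => [|j y1 y2 _ ->]; first by rewrite spform0l.
by rewrite spformDl spformZl.
Qed.

Lemma xU_xgen i v a k b : spform (e_ i) v = 0 -> k != -% i ->
  (xU i v a * xgen i k b)%g = xU i (v + b *: e_ k) (a + spform v (e_ k) * b).
Proof.
move=> vi ki; rewrite !xU_def xprod_step.
- by rewrite pairing_perp.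
- by rewrite filter_uniq // enum_uniq.
- by apply/allP => j; rewrite mem_filter => /andP[].
- by rewrite mem_filter ki mem_enum.
Qed.

Lemma xU0 i : xU i 0 0 = 1%g.
Proof.
rewrite xU_def; elim: (perp_idx i) => [|j s IHs] /=; first by rewrite subr0 zgen0 mulg1.
by rewrite mxE xgen0 mul1g mul0r subr0.
Qed.

Lemma xU_zgen i v a b : (xU i v a * zgen i b)%g = xU i v (a + b).
Proof. by rewrite !xU_def -mulgA zgenD; congr (_ * zgen _ _)%g; ring. Qed.

Lemma zgenE i a : zgen i a = xU i 0 a.
Proof. by rewrite -[a in RHS]add0r -xU_zgen xU0 mul1g. Qed.

Lemma xgenE i k b : k != -% i -> xgen i k b = xU i (b *: e_ k) 0.
Proof.
move=> ki; rewrite -[xgen _ _ _]mul1g -(xU0 i) xU_xgen ?spform0r //.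
by rewrite add0r spform0l mul0r addr0.
Qed.

(** Vectors supported in P are built up one coordinate at a time, all partial
    sums being supported in P. *)
Lemma vec_ind (P : pred I) (Q : V -> Prop) :
    Q 0 ->
    (forall w k c, P k -> (forall m, ~~ P m -> w m 0 = 0) -> Q w ->
      Q (w + c *: e_ k)) ->
  forall w, (forall m, ~~ P m -> w m 0 = 0) -> Q w.
Proof.
move=> Q0 QS w hw.
suff H s : let w' := \sum_(j <- s) w j 0 *: e_ j in
    Q w' /\ (forall m, ~~ P m -> w' m 0 = 0).
  rewrite [w]matrix_sum_delta.
  have [+ _] := H (enum 'I_(2 * l)); rewrite big_enum /=; congr Q.
  by apply: eq_bigr => j _; rewrite big_ord1.
elim: s => [|j s] /=; first by rewrite big_nil; split => // m _; rewrite mxE.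
rewrite big_cons addrC; set w' := \sum_(j <- s) _ => -[Qw' hw'].
have [Pj|nPj] := boolP (P j); last by rewrite hw // scale0r addr0.
split; first exact: QS.
move=> m nPm; rewrite !mxE hw' // add0r (negbTE (_ : m != j)) ?mulr0 //.
by apply: contraNneq nPm => ->.
Qed.

Lemma perp_coord i w : spform (e_ i) w = 0 <-> w (-% i) 0 = 0.
Proof.
rewrite coordE rev_ordK; split=> [->|h]; first by rewrite mulr0.
have := congr1 ( *%R (- sgn (-% i))) h; rewrite mulr0 mulrA mulrNN sgn_sqr mul1r.
by [].
Qed.

Lemma perp_ind i (Q : V -> Prop) :
    Q 0 ->
    (forall w k c, k != -% i -> spform (e_ i) w = 0 -> Q w ->
      Q (w + c *: e_ k)) ->
  forall w, spform (e_ i) w = 0 -> Q w.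
Proof.
move=> Q0 QS w /perp_coord hw; apply: (vec_ind (P := fun k => k != -% i)) => //.
- move=> {hw}w k c ki hw Qw; apply: QS => //.
  by apply/perp_coord/hw; rewrite eqxx.
- by move=> m; rewrite negbK => /eqP ->.
Qed.

(** P1 for u = e_i.  The second argument is built from generators, and
    multiplying by one generator is [xU_xgen]. *)
Lemma xUM i v w a b : spform (e_ i) v = 0 -> spform (e_ i) w = 0 ->
  (xU i v a * xU i w b)%g = xU i (v + w) (a + b + spform v w).
Proof.
move=> vi wi; elim/perp_ind: w / wi a b => [a b|w k c ki wi IHw a b].
  by rewrite -zgenE xU_zgen addr0 spform0r addr0.
have -> : b = b - spform w (e_ k) * c + spform w (e_ k) * c by ring.
rewrite -xU_xgen // mulgA IHw xU_xgen ?spformDr ?vi ?wi ?addr0 // addrA.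
by rewrite [v + (w + _)]addrA spformZr (spformDl v w); congr xU; ring.
Qed.

(** P4 for u = e_i, in a form that also lets a multiple of e_i be absorbed. *)
Lemma xU_P4 i v a c : spform (e_ i) v = 0 -> xU i (v + c *: e_ i) a = xU i v (a + 2 * c).
Proof.
move=> vi; have := xU_xgen a c vi (rev_ord_neqC i).
by rewrite {1}/xgen eqxx -/(zgen _ _) xU_zgen spform_skew vi oppr0 mul0r addr0 => <-.
Qed.

(** P2 for two basis vectors; this is R0. *)
Lemma xU_sym i j c : j != -% i -> xU i (c *: e_ j) 0 = xU j (c *: e_ i) 0.
Proof.
move=> ji; have ij : i != -% j by rewrite rev_ord_eqC.
have [->//|nij] := eqVneq i j.
rewrite -!xgenE // /xgen (negbTE nij) eq_sym (negbTE nij) stX_R0 rev_ordK.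
congr stX; rewrite sgn_rev.
by transitivity (c * sgn i * (sgn j * sgn j)); [ring | rewrite sgn_sqr mulr1].
Qed.

Lemma xUV i v a : spform (e_ i) v = 0 -> (xU i v a)^-1%g = xU i (- v) (- a).
Proof.
move=> vi; apply: (mulgI (xU i v a)); rewrite mulgV xUM //.
  by rewrite !subrr -scaleN1r spformZr spform_alt mulr0 addr0 xU0.
by rewrite -scaleN1r spformZr vi mulr0.
Qed.

Lemma stX_short i j a : i != j -> j != -% i ->
  stX i j a = xU i ((a * sgn (-% j)) *: e_ (-% j)) 0.
Proof.
move=> nij nj; rewrite -xgenE ?(inj_eq rev_ord_inj) 1?eq_sym //.
rewrite /xgen (negbTE (_ : -% j != i)); last by rewrite eq_sym rev_ord_eqC.
by rewrite rev_ordK -mulrA sgn_sqr mulr1.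
Qed.

Lemma stX_long i a : stX i (-% i) a = xU i 0 a.
Proof. exact: zgenE. Qed.

Lemma rho_xgen i k c : k != -% i -> rho (xgen i k c) = T (e_ i) (c *: e_ k) 0.
Proof.
move=> ki; rewrite /xgen; case: eqP => [->|/eqP nki].
  by rewrite rho_stX ?rev_ord_neqC // Tel_long Tdbl.
have nik : -% k != -% i by rewrite (inj_eq rev_ord_inj).
have ik : i != -% k by rewrite rev_ord_eqC.
rewrite (rho_stX _ ik) (Tel_short _ nik).
by rewrite rev_ordK -mulrA sgn_sqr mulr1.
Qed.

Lemma rho_xU i v a : spform (e_ i) v = 0 -> rho (xU i v a) = T (e_ i) v a.
Proof.
move=> vi; elim/perp_ind: v / vi a => [a|v k c ki vi IHv a].
  by rewrite -stX_long rho_stX ?rev_ord_neqC // Tel_long.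
have -> : a = a - spform v (e_ k) * c + spform v (e_ k) * c by ring.
rewrite -xU_xgen // rhoM IHv rho_xgen // Tadd ?spformZr ?spform_e0 // ?mulr0 //.
by apply: Tcongr => //; ring.
Qed.

End Unipotent.

(** * Elements acting correctly on a unipotent radical *)
Section Parabolic.
Variables (R : comPzRingType) (l : nat).
Local Notation I := 'I_(2 * l).
Local Notation V := 'cV[R]_(2 * l).
Local Notation G := (StSp R l).
Local Notation "-% i" := (rev_ord i) (at level 35).
Implicit Types (i j k : I) (u v w : V) (a b c : R) (g : G) (s : seq I).

Lemma xU_congr i v v' a a' : v = v' -> a = a' -> xU i v a = xU i v' a'.
Proof. by move=> -> ->. Qed.

(** g stabilises e_i and its conjugation action on U_i is the one prescribed by
    P3.  That the second condition follows from the first one is only known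
    at the end, from the equivariance of long root elements. *)
Definition fixes g i := rho g *m e_ i = e_ i /\
  forall v a, spform (e_ i) v = 0 -> (g * xU i v a = xU i (rho g *m v) a * g)%g.

Lemma fixes_perp g i v : rho g *m e_ i = e_ i ->
  spform (e_ i) (rho g *m v) = spform (e_ i) v.
Proof. by move=> {1}<-; rewrite rho_form. Qed.

Lemma fixesM g g' i : fixes g i -> fixes g' i -> fixes (g * g')%g i.
Proof.
move=> [ge gx] [ge' gx']; split=> [|v a vi].
  by rewrite rhoM -mulmxA ge' ge.
rewrite -mulgA gx' // mulgA gx ?fixes_perp //.
by rewrite rhoM -!mulmxA mulgA.
Qed.

Lemma fixesV g i : fixes g i -> fixes g^-1%g i.
Proof.
move=> [ge gx]; have ge' : rho g^-1%g *m e_ i = e_ i.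
  by rewrite -{1}ge mulmxA rhoVK mul1mx.
split=> // v a vi; rewrite -{1}[v]mul1mx -(rhoK g) -mulmxA.
apply: slideV; rewrite -gx ?fixes_perp //.
Qed.

Lemma fixes_xU_same i w b : spform (e_ i) w = 0 -> fixes (xU i w b) i.
Proof.
move=> wi; have e : rho (xU i w b) *m e_ i = e_ i.
  rewrite rho_xU // mulTmx spform_alt (spform_skew (e_ i) w) wi.
  by rewrite mulr0 oppr0 addr0 !scale0r !addr0.
split=> // v a vi; rewrite xUM // rho_xU // mulTmx vi mulr0 addr0 scale0r addr0.
rewrite xU_P4 // xUM // [v + w]addrC; congr xU.
by rewrite (spform_skew w v); ring.
Qed.

Lemma xgen_stX i p c : p != -% i -> p != i -> xgen i p c = stX p (-% i) (c * sgn i).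
Proof.
move=> h1 h2; rewrite /xgen (negbTE h2) stX_R0 rev_ordK; congr stX.
rewrite sgn_rev.
by transitivity (c * sgn i * (sgn p * sgn p)); [ring | rewrite sgn_sqr mulr1].
Qed.

(** The action of a generator of the Levi subgroup on U_i: R4 if it is a long
    root element, R3 otherwise.  In both cases R0 brings the generator of U_i
    to the form X_q,-i. *)
Lemma stX_xgen i p q b c : p != q -> i != p -> i != -% p -> i != q -> i != -% q ->
  (stX p q b * xgen i q c = xU i (Tel p q b *m (c *: e_ q)) 0 * stX p q b)%g.
Proof.
move=> npq ip ip' iq iq'; have pi' : p != -% i by rewrite rev_ord_eqC.
have qi' : q != -% i by rewrite rev_ord_eqC.
have [qp|nqp] := eqVneq q (-% p).
  rewrite qp in qi' iq iq' npq *; rewrite -scalemxAr Tel_long mulTmx.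
  rewrite spform0l add0r spform_ee scaler0 addr0 xgen_stX //; last by rewrite eq_sym.
  rewrite stX_R4 //.
  have -> : b * (c * sgn i) * sgn p = c * b * sgn p * sgn i by ring.
  rewrite -xgen_stX //; last by rewrite eq_sym.
  have -> : - (b * (c * sgn i) ^+ 2) = - (b * c ^+ 2).
    by rewrite exprMn expr2 expr2 sgn_sqr mulr1.
  rewrite -(xgen_stX c qi'); last by rewrite eq_sym.
  rewrite mulgA rev_ordK -/(zgen i _) zgenE xgenE // xgenE //.
  congr (_ * _)%g; rewrite xUM ?spform0r ?spformZr ?spform_e0 ?mulr0 //.
  rewrite xUM ?spformDr ?spform0r ?spformZr ?spform_e0 ?mulr0 ?addr0 //.
  apply: xU_congr; first by rewrite scalerDr scalerA addrC !mulrA.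
  rewrite spformZl spform_ee.
  transitivity (b * c ^+ 2 * (sgn p * sgn p - 1)); first by ring.
  by rewrite sgn_sqr subrr mulr0.
rewrite -scalemxAr Tel_ej // xgen_stX //; last by rewrite eq_sym.
rewrite stX_R3 //; first last.
- by rewrite rev_ordK eq_sym.
- by rewrite rev_ordK eq_sym.
- by rewrite rev_ord_eqC.
rewrite mulrA -!xgen_stX //; try by rewrite eq_sym.
rewrite mulgA; congr (_ * _)%g; rewrite !xgenE // xUM ?spformZr ?spform_e0 ?mulr0 //.
apply: xU_congr; first by rewrite scalerDr scalerA addrC [c * b]mulrC.
by rewrite spformZl spform_e0 // !mulr0 !addr0.
Qed.

(** It suffices to know the action on generators of U_i, since the
    multiplication law of U_i is preserved by isometries. *)
Lemma fixes_gen g i : rho g *m e_ i = e_ i ->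
    (forall k c, k != -% i ->
      (g * xgen i k c = xU i (rho g *m (c *: e_ k)) 0 * g)%g) ->
    (forall a, (g * xU i 0 a = xU i 0 a * g)%g) ->
  fixes g i.
Proof.
move=> ge gx gz; split=> // v a vi; elim/perp_ind: v / vi a => [a|v k c ki vi IHv a].
  by rewrite mulmx0.
have -> : a = a - spform v (e_ k) * c + spform v (e_ k) * c by ring.
have ek : spform (e_ i) (c *: e_ k) = 0 by rewrite spformZr spform_e0 ?mulr0.
rewrite -xU_xgen // mulgA IHv // -mulgA gx // mulgA xUM ?fixes_perp //.
by rewrite mulmxDr rho_form spformZr; congr (xU _ _ _ * _)%g; ring.
Qed.

(** A generator fixing e_i lies in U_i or fixes e_-i as well; in the latter
    case R2 settles all generators of U_i but those in [stX_xgen]. *)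
Lemma fixes_stX i p q b : i != q -> i != -% p -> fixes (stX p q b) i.
Proof.
move=> iq ip'; have [->|npq] := eqVneq p q.
  rewrite stXii; apply: fixes_gen; first by rewrite rho1 mul1mx.
    by move=> k c ki; rewrite rho1 mul1mx -xgenE // mul1g mulg1.
  by move=> a; rewrite mul1g mulg1.
have XU (m n : I) d : m != n -> fixes (stX m n d) m.
  move=> nmn; have [->|nnm] := eqVneq n (-% m).
    by rewrite stX_long; apply: fixes_xU_same; rewrite spform0r.
  by rewrite stX_short //; apply: fixes_xU_same; exact: spform_Tel.
have [->|ip] := eqVneq i p; first exact: XU.
have [->|iq'] := eqVneq i (-% q).
  by rewrite stX_R0; apply: XU; rewrite (inj_eq rev_ord_inj) eq_sym.
have pi' : p != -% i by rewrite rev_ord_eqC.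
have qi' : q != -% i by rewrite rev_ord_eqC.
have zX a : (stX p q b * xU i 0 a = xU i 0 a * stX p q b)%g.
  rewrite -stX_long; apply: stX_R2 => //.
  - by rewrite eq_sym rev_ord_eqC.
  - by rewrite (inj_eq rev_ord_inj).
apply: fixes_gen => //; first by rewrite rho_stX // Tel_e.
move=> k c ki; rewrite rho_stX //.
have [->|kq] := eqVneq k q; first exact: stX_xgen.
have [kp|kp] := eqVneq k (-% p).
  rewrite kp stX_R0 Tel_R0; apply: stX_xgen; rewrite ?(inj_eq rev_ord_inj) ?rev_ordK //.
  by rewrite eq_sym.
rewrite -scalemxAr Tel_e // -xgenE //; have [->|kiN] := eqVneq k i.
  by rewrite xgen_ii /zgen stX_long zX.
rewrite /xgen (negbTE kiN); apply: stX_R2 => //.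
- by rewrite eq_sym rev_ord_eqC.
- by rewrite (inj_eq rev_ord_inj).
Qed.

(** If w has no component along e_-i, then x_j(w) is a product of generators
    that all fix e_i. *)
Lemma fixes_xU i j w b : j != -% i -> spform (e_ j) w = 0 ->
  spform (e_ i) w = 0 -> fixes (xU j w b) i.
Proof.
move=> ji /perp_coord wj /perp_coord wi.
have ij : i != -% j by rewrite rev_ord_eqC.
pose P (m : I) := (m != -% j) && (m != -% i).
have hw m : ~~ P m -> w m 0 = 0.
  by rewrite negb_and !negbK => /orP[] /eqP ->.
move: b; apply: (@vec_ind R l P (fun w => forall b, fixes (xU j w b) i)) hw.
  by move=> b; rewrite -stX_long; apply: fixes_stX.
move=> v k c /andP[kj ki] hv IHv b.
have vj : spform (e_ j) v = 0 by apply/perp_coord/hv; rewrite /P eqxx.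
have -> : b = b - spform v (e_ k) * c + spform v (e_ k) * c by ring.
rewrite -xU_xgen //; apply: fixesM; first exact: IHv.
rewrite /xgen; case: eqP => _; first exact: fixes_stX.
by apply: fixes_stX; rewrite // rev_ord_eqC.
Qed.

End Parabolic.

(** * Conjugation *)
Section Conjugation.
Local Open Scope group_scope.
Variable H : groupType.
Implicit Types g h x y z : H.

Definition cj : H -> H -> H := locked_with steinberg_key (fun g x => g * x * g^-1).

Lemma cjE g x : cj g x = g * x * g^-1.
Proof. by rewrite /cj unlock. Qed.

Lemma cjM g x y : cj g (x * y) = cj g x * cj g y.
Proof. by rewrite !cjE !mulgA mulgVK. Qed.

Lemma cjMl g h x : cj (g * h) x = cj g (cj h x).
Proof. by rewrite !cjE invgM !mulgA. Qed.

Lemma cj1 g : cj g 1 = 1.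
Proof. by rewrite !cjE mulg1 mulgV. Qed.

Lemma cj1l x : cj 1 x = x.
Proof. by rewrite !cjE mul1g invg1 mulg1. Qed.

Lemma cjV g x : cj g x^-1 = (cj g x)^-1.
Proof. by apply: (mulgI (cj g x)); rewrite -cjM !mulgV cj1. Qed.

Lemma cjK g x y : cj g x = y -> cj g^-1 y = x.
Proof. by move=> <-; rewrite -cjMl mulVg cj1l. Qed.

Lemma cj_slide g x y : cj g x = y <-> g * x = y * g.
Proof. by rewrite !cjE; split=> [<-|->]; rewrite ?mulgVK ?mulgK. Qed.

Lemma commuteA x y : commute x y -> forall u, u * x * y = u * y * x.
Proof. by move=> xy u; rewrite -!mulgA xy. Qed.

Lemma cj_flip x y : cj x y = x * cj y x^-1 * y.
Proof. by rewrite !cjE !mulgA mulgVK. Qed.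

Lemma cj_commute g x : cj g x = x <-> commute g x.
Proof. exact: cj_slide. Qed.

End Conjugation.

(** * Long root elements of vectors orthogonal to a hyperbolic plane *)
Section LongRoots.
Variables (R : comPzRingType) (l : nat).
Local Notation I := 'I_(2 * l).
Local Notation V := 'cV[R]_(2 * l).
Local Notation G := (StSp R l).
Local Notation "-% i" := (rev_ord i) (at level 35).
Implicit Types (i j k m : I) (u v w y z : V) (a b c r s : R) (g h : G).

Lemma spformNl u v : spform (- u) v = - spform u v.
Proof. by rewrite -scaleN1r spformZl mulN1r. Qed.

Lemma spformNr u v : spform u (- v) = - spform u v.
Proof. by rewrite -scaleN1r spformZr mulN1r. Qed.

Definition spE := (spformNl, spformNr, @spformDl R l, @spformDr R l,
  @spformZl R l, @spformZr R l, @spform0l R l, @spform0r R l, @spform_alt R l).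

Lemma fixes_cj g i v a : fixes g i -> spform (e_ i) v = 0 ->
  cj g (xU i v a) = xU i (rho g *m v) a.
Proof. by move=> [_ gx] vi; apply/cj_slide; exact: gx. Qed.

Lemma fixes_conj g h i : fixes g i -> fixes h i -> fixes (cj g h) i.
Proof.
by move=> gi hi; rewrite cjE; apply: fixesM; [exact: fixesM|exact: fixesV].
Qed.

Lemma fixes_commute g i v a : fixes g i -> spform (e_ i) v = 0 ->
  rho g *m v = v -> commute g (xU i v a).
Proof. by move=> gi vi gv; apply/cj_commute; rewrite fixes_cj // gv. Qed.

Lemma T_long_fix u v a : spform u v = 0 -> T u 0 a *m v = v.
Proof. by move=> uv; rewrite mulTmx !spE uv mulr0 addr0 !scale0r !addr0. Qed.

(** This identity ties short root elements to long ones; the whole proof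
    is modelled on it. *)
Lemma T_long_add u v a : spform u v = 0 ->
  T (u + v) 0 a = T u 0 a *m T v 0 a *m T u (a *: v) 0.
Proof.
move=> uv; apply: mx_ext => w; rewrite -!mulmxA !mulTmx !spE uv.
rewrite (spform_skew u v) uv; apply/colP => i; rewrite !mxE; ring.
Qed.

(** w is orthogonal to the hyperbolic plane H_k spanned by e_k and e_-k. *)
Definition perp k w := spform (e_ k) w = 0 /\ spform (e_ (-% k)) w = 0.

Lemma perp_rev k w : perp k w -> perp (-% k) w.
Proof. by case=> h1 h2; split; rewrite ?rev_ordK. Qed.

Lemma perp0 k : perp k 0.
Proof. by split; rewrite spform0r. Qed.

Lemma perpD k u v : perp k u -> perp k v -> perp k (u + v).
Proof. by case=> h1 h2 [h3 h4]; split; rewrite spformDr ?h1 ?h2 ?h3 ?h4 addr0. Qed.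

Lemma perpZ k u a : perp k u -> perp k (a *: u).
Proof. by case=> h1 h2; split; rewrite spformZr ?h1 ?h2 mulr0. Qed.

Lemma perp_e j k : j != k -> j != -% k -> perp k (e_ j).
Proof. by move=> h1 h2; split; apply: spform_e0; rewrite ?rev_ordK. Qed.

(** The hyperbolic planes H_j and H_k are distinct. *)
Definition apart j k := (j != k) && (j != -% k).

Lemma apartC j k : apart j k = apart k j.
Proof. by rewrite /apart eq_sym rev_ord_eqC. Qed.
Lemma apart_rev j k : apart j (-% k) = apart j k.
Proof. by rewrite /apart rev_ordK andbC. Qed.
Lemma apart_revl j k : apart (-% j) k = apart j k.
Proof. by rewrite apartC apart_rev apartC. Qed.

Lemma perp_ap j k : apart j k -> perp k (e_ j).
Proof. by case/andP; exact: perp_e. Qed.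

(** An element of U_-k that sends e_k to e_k + w, see [shear_e]. *)
Definition shear k w : G := xU (-% k) (sgn (-% k) *: w) 0.

(** The lift of T(w,0,a) read off from
      T(e_k + w,0,a) = T(e_k,0,a) T(w,0,a) T(e_k,wa,0),
    the left-hand side being a conjugate of T(e_k,0,a); see [shear_long]. *)
Definition longT : I -> V -> R -> G := locked_with steinberg_key (fun k w a =>
  xU k 0 (- a) * cj (shear k w) (xU k 0 a) * xU k (- a *: w) 0)%g.

Lemma longT_def k w a :
  longT k w a = (xU k 0 (- a) * cj (shear k w) (xU k 0 a) * xU k (- a *: w) 0)%g.
Proof. by rewrite /longT unlock. Qed.

Lemma shear_perp k w : perp k w -> spform (e_ (-% k)) (sgn (-% k) *: w) = 0.
Proof. by case=> _ h; rewrite spformZr h mulr0. Qed.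

Lemma rho_shear k w v : perp k w -> rho (shear k w) *m v =
  v + (sgn (-% k) * spform w v) *: e_ (-% k)
    + (sgn (-% k) * spform (e_ (-% k)) v) *: w.
Proof.
move=> wk; rewrite /shear rho_xU ?shear_perp // mulTmx !spE mul0r addr0 scalerA.
by rewrite [_ * sgn _]mulrC.
Qed.

Lemma shear_e k w : perp k w -> rho (shear k w) *m e_ k = e_ k + w.
Proof.
move=> wk; rewrite rho_shear // (spform_skew _ w) wk.1 oppr0 mulr0 scale0r addr0.
by rewrite -{4}[k]rev_ordK spform_ee sgn_sqr scale1r.
Qed.

Lemma shearD k v w : perp k v -> perp k w -> spform v w = 0 ->
  shear k (v + w) = (shear k v * shear k w)%g.
Proof.
by move=> vk wk vw; rewrite /shear xUM ?shear_perp // !spE vw !mulr0 !addr0 scalerDr.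
Qed.

Lemma shear_long k w a : perp k w ->
  cj (shear k w) (xU k 0 a) = (xU k 0 a * longT k w a * xU k (a *: w) 0)%g.
Proof.
move=> wk; rewrite longT_def !mulgA xUM ?spE // subrr !addr0 xU0 mul1g -mulgA.
by rewrite xUM ?spE ?wk.1 ?mulr0 // !addr0 scaleNr addNr xU0 mulg1.
Qed.

Lemma shear0 k : shear k 0 = 1%g.
Proof. by rewrite /shear scaler0 xU0. Qed.

Lemma longT0 k a : longT k 0 a = 1%g.
Proof.
by rewrite longT_def shear0 cj1l scaler0 xU0 mulg1 xUM ?spE // !addr0 addNr xU0.
Qed.

Lemma longT_0 k w : longT k w 0 = 1%g.
Proof. by rewrite longT_def oppr0 xU0 cj1 scale0r xU0 !mulg1. Qed.

(** Every factor of longT lies in U_k or U_-k. *)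
Lemma longT_levi g k w a : fixes g k -> fixes g (-% k) -> perp k w ->
  cj g (longT k w a) = longT k (rho g *m w) a.
Proof.
move=> gk gk' wk; have gN : cj g (shear k w) = shear k (rho g *m w).
  by rewrite /shear fixes_cj ?shear_perp // -scalemxAr.
have g0 b : cj g (xU k 0 b) = xU k 0 b by rewrite fixes_cj ?spE ?mulmx0.
rewrite !longT_def !cjM !g0 (fixes_cj _ gk) ?spE ?wk.1 ?mulr0 // -scalemxAr.
by congr (_ * _ * _)%g; rewrite [cj (shear k w) _]cjE !cjM cjV gN g0 -cjE.
Qed.

Lemma longT_commute g k w a : fixes g k -> fixes g (-% k) -> perp k w ->
  rho g *m w = w -> commute g (longT k w a).
Proof. by move=> gk gk' wk gw; apply/cj_commute; rewrite longT_levi // gw. Qed.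

Lemma rho_cj g h : rho (cj g h) = rho g *m rho h *m rho g^-1%g.
Proof. by rewrite cjE !rhoM. Qed.

Lemma rho_longT k w a : perp k w -> rho (longT k w a) = T w 0 a.
Proof.
move=> wk; rewrite longT_def !rhoM rho_cj !(@rho_xU _ _ k) ?spE ?wk.1 ?mulr0 //.
rewrite (Tconj _ _ _ (@rho_form _ _ (shear k w))).
rewrite shear_e // mulmx0 -(mulmxA _ _ (rho _)) rhoK mulmx1 T_long_add ?wk.1 //.
rewrite -!mulmxA Tadd ?spE ?wk.1 ?mulr0 // !addr0.
rewrite scaleNr subrr T00 mulmx1 mulmxA Tadd ?spE //.
by rewrite !addr0 addNr T00 mul1mx.
Qed.

Lemma fixes_shear k w m : apart m k -> perp k w -> spform (e_ m) w = 0 ->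
  fixes (shear k w) m.
Proof.
move=> /andP[mk mk'] wk wm; apply: fixes_xU; rewrite ?shear_perp //.
  by rewrite (inj_eq rev_ord_inj) eq_sym.
by rewrite spformZr wm mulr0.
Qed.

Lemma fixes_xU_apart k w a m : apart m k -> spform (e_ k) w = 0 ->
  spform (e_ m) w = 0 -> fixes (xU k w a) m.
Proof.
by move=> /andP[mk mk'] wk wm; apply: fixes_xU; rewrite // rev_ord_eqC.
Qed.

(** If w has no component along e_-m, all factors of longT fix e_m. *)
Lemma fixes_longT k w a m : apart m k -> perp k w -> spform (e_ m) w = 0 ->
  fixes (longT k w a) m.
Proof.
move=> mk wk wm; have Nm := fixes_shear mk wk wm.
rewrite longT_def; apply: fixesM; last first.
  by apply: fixes_xU_apart; rewrite ?spE ?wk.1 ?wm ?mulr0.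
apply: fixesM; first by apply: fixes_xU_apart; rewrite ?spE.
by apply: fixes_conj => //; apply: fixes_xU_apart; rewrite ?spE.
Qed.

End LongRoots.

(** * Short root elements and the key commutator *)
Section ShortRoots.
Variables (R : comPzRingType) (l : nat).
Local Notation I := 'I_(2 * l).
Local Notation V := 'cV[R]_(2 * l).
Local Notation G := (StSp R l).
Local Notation "-% i" := (rev_ord i) (at level 35).
Implicit Types (i j k m : I) (u v w y z : V) (a b c r s : R) (g : G).
Local Notation spE := (spE R l).

Lemma perp_skew k w : perp k w -> spform w (e_ k) = 0 /\ spform w (e_ (-% k)) = 0.
Proof. by case=> h1 h2; split; rewrite spform_skew ?h1 ?h2 oppr0. Qed.

(** Lifts T(w + c e_j,0,a) = T(c e_j,0,a) T(w,0,a) T(e_j,wac,0).  Here the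
    computation takes place in the stabiliser of e_j, because the shear along
    c e_j also belongs to U_j. *)
Lemma longT_add_e j k w a c : apart j k -> perp k w -> spform (e_ j) w = 0 ->
  longT k (w + c *: e_ j) a =
    (xU j 0 (a * c ^+ 2) * longT k w a * xU j ((a * c) *: w) 0)%g.
Proof.
move=> jk wk wj; have kj : apart k j by rewrite apartC.
have ek : perp k (e_ j : V) by exact: perp_ap.
have [fjk _] : perp j (e_ k : V) by exact: perp_ap.
have [fjk' _] : perp j (e_ (-% k) : V) by apply: perp_ap; rewrite apart_revl.
have wjk : spform w (e_ j) = 0 by rewrite spform_skew wj oppr0.
have Nj : fixes (shear k w) j by apply: fixes_shear.
have Lj : fixes (longT k w a) j by apply: fixes_longT.
have kx : fixes (xU k 0 a) j by apply: fixes_xU_apart; rewrite ?spE.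
pose v0 : V := (sgn (-% k) * c) *: e_ (-% k).
have v0j : spform (e_ j) v0 = 0 by rewrite spformZr fjk' mulr0.
have NE : shear k (w + c *: e_ j) = (shear k w * xU j v0 0)%g.
  rewrite shearD ?spE ?wjk ?mulr0 //; last exact: perpZ.
  have jkk : j != -% (-% k) by rewrite rev_ordK; case/andP: jk.
  by rewrite {2}/shear scalerA (xU_sym _ jkk).
have kv0 : spform (e_ k) v0 = - c.
  rewrite spformZr spform_ee sgn_rev.
  by transitivity (- c * (sgn k * sgn k)); [ring | rewrite sgn_sqr mulr1].
clearbody v0.
(* The commutator of v0 in U_j with the long root element of e_k, read as
   the effect of the latter on U_j. *)
have c1 : cj (xU j v0 0) (xU k 0 a) = (xU j ((a * c) *: e_ k) (a * c ^+ 2) * xU k 0 a)%g.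
  have v0N : spform (e_ j) (- v0) = 0 by rewrite spformNr v0j oppr0.
  rewrite cj_flip xUV // oppr0 fixes_cj // rho_xU ?spE // mulTmx !spE kv0 oppr0 add0r.
  rewrite scaler0 addr0 xUM // ?spE ?v0j ?fjk ?mulr0 ?addr0 ?oppr0 // add0r.
  rewrite (spform_skew _ v0) kv0; congr (xU _ _ _ * _)%g; last by ring.
  by rewrite addNKr; congr (_ *: _); ring.
have e : cj (shear k (w + c *: e_ j)) (xU k 0 a) =
    (xU j ((a * c) *: (e_ k + w)) (a * c ^+ 2) * (xU k 0 a * longT k w a * xU k (a *: w) 0))%g.
  rewrite NE cjMl c1 cjM shear_long // fixes_cj ?spE ?fjk ?mulr0 //.
  by rewrite -scalemxAr shear_e.
apply: (mulgI (xU k 0 a)); apply: (mulIg (xU k (a *: (w + c *: e_ j)) 0)).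
rewrite -shear_long; last by apply: perpD => //; exact: perpZ.
have -> : a *: (w + c *: e_ j) = (a * c) *: e_ j + a *: w.
  by rewrite scalerDr scalerA addrC.
rewrite e.
have -> : xU k ((a * c) *: e_ j + a *: w) 0 =
    (xU j ((a * c) *: e_ k) 0 * xU k (a *: w) 0)%g.
  have jk' : j != -% k by case/andP: jk.
  rewrite -(xU_sym _ jk') xUM ?spE ?ek.1 ?wk.1 ?mulr0 //.
  by rewrite (spform_skew w) wjk oppr0 !mulr0 !addr0.
rewrite !mulgA; congr (_ * _)%g.
have xc v b : spform (e_ k) v = 0 -> spform (e_ j) v = 0 -> commute (xU k 0 a) (xU j v b).
  by move=> kv jv; apply: fixes_commute => //; rewrite rho_xU ?spE // T_long_fix.
have Lc v b : spform w v = 0 -> spform (e_ j) v = 0 -> commute (longT k w a) (xU j v b).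
  by move=> wv jv; apply: fixes_commute => //; rewrite rho_longT // T_long_fix.
have [wkk _] := perp_skew wk.
have [v vE] : exists v : V, v = (a * c) *: w + (a * c) *: e_ k by eexists.
have -> : (a * c) *: (e_ k + w) = v by rewrite vE -scalerDr addrC.
have vj : spform (e_ j) v = 0 by rewrite vE !spE wj fjk !mulr0 addr0.
have vw : spform w v = 0 by rewrite vE !spE wkk !mulr0 addr0.
have vk : spform (e_ k) v = 0 by rewrite vE !spE wk.1 !mulr0 addr0.
have -> : xU j v (a * c ^+ 2) = (xU j 0 (a * c ^+ 2) * xU j v 0)%g.
  by rewrite xUM ?spE // add0r !addr0.
have xv : (xU j ((a * c) *: w) 0 * xU j ((a * c) *: e_ k) 0)%g = xU j v 0.
  by rewrite xUM ?spE ?wj ?fjk ?wkk ?mulr0 // !addr0 vE.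
rewrite -[RHS]mulgA xv (commuteA (Lc _ 0 vw vj)); congr (_ * _)%g.
by rewrite (commuteA (commute_sym (xc _ 0 vk vj))) xc ?spE.
Qed.

Lemma longT_e j k a : apart j k -> longT k (e_ j) a = xU j 0 a.
Proof.
move=> jk; rewrite -[e_ j]add0r -[e_ j]scale1r longT_add_e ?spE //; last exact: perp0.
by rewrite longT0 mulg1 scaler0 expr1n mulr1 xU0 mulg1.
Qed.

(** The auxiliary plane does not matter.  Shearing the long root element of e_j
    along w lifts T(e_j + w,0,a).  As that element is longT k (e_j) a, and the
    shear acts correctly on U_k and U_-k, the result is longT k (e_j + w) a;
    now compare with [longT_add_e]. *)
Lemma longT_indep j k w a : apart j k -> perp j w -> perp k w -> longT j w a = longT k w a.
Proof.
move=> jk wj wk; have kj : apart k j by rewrite apartC.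
have ekj : perp k (e_ j : V) by exact: perp_ap.
have Nk : fixes (shear j w) k by apply: fixes_shear => //; exact: wk.1.
have Nk' : fixes (shear j w) (-% k).
  by apply: fixes_shear; rewrite ?apart_revl //; exact: wk.2.
apply: (mulgI (xU j 0 a)); apply: (mulIg (xU j (a *: w) 0)).
rewrite -shear_long // -{1}(longT_e _ jk) longT_levi // shear_e // addrC.
rewrite -[e_ j]scale1r longT_add_e //.
  by rewrite expr1n !mulr1.
exact: wj.1.
Qed.

(** With a second plane at hand, longT also acts correctly on the radicals that
    were used to define it. *)
Lemma fixes_longT2 j k w a : apart j k -> perp j w -> perp k w ->
  fixes (longT j w a) j /\ fixes (longT j w a) (-% j).
Proof.
move=> jk wj wk; rewrite (longT_indep _ jk) //; split; apply: fixes_longT => //.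
- exact: wj.1.
- by rewrite apart_revl.
- exact: wj.2.
Qed.

(** The lift of T(z, y, 0) for y = r e_j + s e_-j and z orthogonal to H_j.
    Since T(z,y,0) = T(y,z,0), one expects the product of T(e_j,zr,0) and
    T(e_-j,zs,0); P1 for the vector z gives the correcting long root element. *)
Definition shortT : I -> V -> R -> R -> G := locked_with steinberg_key (fun j z r s =>
  xU j (r *: z) 0 * xU (-% j) (s *: z) 0 * longT j z (- (sgn j * r * s)))%g.

Lemma shortT_def j z r s : shortT j z r s =
  (xU j (r *: z) 0 * xU (-% j) (s *: z) 0 * longT j z (- (sgn j * r * s)))%g.
Proof. by rewrite /shortT unlock. Qed.

Definition hyp j r s : V := r *: e_ j + s *: e_ (-% j).

Lemma perp_hyp j k r s : apart j k -> perp k (hyp j r s).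
Proof.
move=> jk; apply: perpD; apply: perpZ; apply: perp_ap => //.
by rewrite apart_revl.
Qed.

Lemma form_hyp z j r s : perp j z -> spform z (hyp j r s) = 0.
Proof.
by case/perp_skew => h1 h2; rewrite spformDr !spformZr h1 h2 !mulr0 addr0.
Qed.

Lemma xU_hyp k j r s : apart j k ->
  xU k (hyp j r s) 0 =
  (xU j (r *: e_ k) 0 * xU (-% j) (s *: e_ k) 0 * xU k 0 (- (sgn j * r * s)))%g.
Proof.
move=> jk; have [e1 e2] : perp k (e_ j : V) by apply: perp_ap.
have [e3 e4] : perp k (e_ (-% j) : V) by apply: perp_ap; rewrite apart_revl.
case/andP: (jk) => jk1 jk2; have kj2 : k != -% j by rewrite rev_ord_eqC.
have kj1 : k != -% (-% j) by rewrite rev_ordK eq_sym.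
rewrite (xU_sym _ kj2) (xU_sym _ kj1) xUM ?spE ?e1 ?e3 ?mulr0 //.
rewrite xUM ?spE ?e1 ?e3 ?mulr0 ?addr0 // spform_ee.
by apply: xU_congr => //; ring.
Qed.

Lemma fixes_shortT j k z r s : apart k j -> perp j z -> spform (e_ k) z = 0 ->
  fixes (shortT j z r s) k.
Proof.
move=> kj zj zk; rewrite shortT_def; apply: fixesM; last exact: fixes_longT.
apply: fixesM; apply: fixes_xU_apart; rewrite ?spE ?zk ?zj.1 ?zj.2 ?mulr0 //.
by rewrite apart_rev.
Qed.

Lemma rho_shortT j z r s : perp j z -> rho (shortT j z r s) = T z (hyp j r s) 0.
Proof.
move=> zj; have [ze ze'] := perp_skew zj.
rewrite shortT_def !rhoM !rho_xU ?spE ?zj.1 ?zj.2 ?mulr0 // rho_longT //.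
rewrite (TC (e_ j)) (TC (e_ (-% j))) !Tadd ?spE ?ze ?ze' ?mulr0 ?addr0 //.
by apply: Tcongr => //; rewrite spform_ee; ring.
Qed.

(** The key commutator.  Split x_k(y) into its components in U_j, U_-j and the
    centre of U_k.  The shear along z acts correctly on U_j and U_-j, and its
    action on the centre of U_k is the definition of longT k z; here longT k z
    coincides with longT j z, which acts correctly on U_k.  Collecting the
    factors from U_k on the right restores x_k(y). *)
Lemma shear_xU_hyp j k z r s : apart j k -> perp j z -> perp k z ->
  cj (shear k z) (xU k (hyp j r s) 0) = (shortT j z r s * xU k (hyp j r s) 0)%g.
Proof.
move=> jk zj zk; have kj : apart k j by rewrite apartC.
have [zej zej'] := perp_skew zj; have [zek zek'] := perp_skew zk.
set c := - (sgn j * r * s).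
have Nj : fixes (shear k z) j by apply: fixes_shear => //; exact: zj.1.
have Nj' : fixes (shear k z) (-% j).
  by apply: fixes_shear; rewrite ?apart_revl //; exact: zj.2.
have [ejk ejk'] : perp j (e_ k : V) by apply: perp_ap.
have [jk1 jk2] := andP jk; have kj2 : k != -% j by rewrite rev_ord_eqC.
have kj1 : k != -% (-% j) by rewrite rev_ordK eq_sym.
have [ekj ekj'] : perp k (e_ j : V) by apply: perp_ap.
have [ekJ ekJ'] : perp k (e_ (-% j) : V) by apply: perp_ap; rewrite apart_revl.
have [Lk _] : fixes (longT k z c) k /\ fixes (longT k z c) (-% k) by apply: (fixes_longT2 (k := j)).
have Lc v b : spform (e_ k) v = 0 -> spform z v = 0 -> commute (longT k z c) (xU k v b).
  by move=> kv zv; apply: fixes_commute => //; rewrite rho_longT // T_long_fix.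
have gk : fixes (xU (-% j) (s *: z) 0) k.
  by apply: fixes_xU_apart; rewrite ?apart_rev // spformZr ?zj.2 ?zk.1 mulr0.
have [u uE] : exists u : V, u = r *: e_ j + (sgn j * r * s) *: z by eexists.
have ku : spform (e_ k) u = 0 by rewrite uE !spE ekj zk.1 !mulr0 addr0.
(* Moving the e_j-component of y past the U_-j factor turns it into u. *)
have gu : (xU k (r *: e_ j) 0 * xU (-% j) (s *: z) 0 = xU (-% j) (s *: z) 0 * xU k u 0)%g.
  have [_ ->] := gk; rewrite // rho_xU ?spformZr ?zj.2 ?mulr0 // mulTmx uE !spE zej.
  have -> : spform (e_ (-% j)) (e_ j) = - sgn j :> R by rewrite spform_skew spform_ee.
  rewrite zj.2 !(mulr0, mul0r, addr0) scale0r addr0 scalerA.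
  congr (xU _ _ _ * _)%g; rewrite -addrA -scalerDl.
  have -> : sgn j * r * s + r * - sgn j * s = 0 by ring.
  by rewrite scale0r addr0.
rewrite {1}xU_hyp // !cjM (fixes_cj _ Nj) ?spE ?ejk ?mulr0 //.
rewrite (fixes_cj _ Nj') ?spE ?ejk' ?mulr0 // -/c shear_long //.
rewrite -!scalemxAr shear_e // !scalerDr ![_ *: e_ k + _]addrC.
have -> : xU j (r *: z + r *: e_ k) 0 = (xU j (r *: z) 0 * xU k (r *: e_ j) 0)%g.
  by rewrite -(xU_sym _ kj2) xUM ?spE ?zj.1 ?ejk ?zek ?mulr0 ?addr0.
have -> : xU (-% j) (s *: z + s *: e_ k) 0 =
    (xU (-% j) (s *: z) 0 * xU k (s *: e_ (-% j)) 0)%g.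
  by rewrite -(xU_sym _ kj1) xUM ?spE ?zj.2 ?ejk' ?zek ?mulr0 ?addr0.
rewrite shortT_def -/c (longT_indep _ jk) // !mulgA -(mulgA (xU j _ _)) gu !mulgA.
have kcz : spform (e_ k) (c *: z) = 0 by rewrite spformZr zk.1 mulr0.
have ksj : spform (e_ k) (s *: e_ (-% j)) = 0 by rewrite spformZr ekJ mulr0.
have zcz : spform z (c *: z) = 0 by rewrite !spE mulr0.
have zsj : spform z (s *: e_ (-% j)) = 0 by rewrite !spE zej' mulr0.
have zu : spform z u = 0 by rewrite uE !spE zej !mulr0 addr0.
have k0 : spform (e_ k) (0 : V) = 0 by rewrite spform0r.
have z0' : spform z (0 : V) = 0 by rewrite spform0r.
rewrite -(commuteA (Lc _ c k0 z0')) -(commuteA (Lc _ 0 ksj zsj)).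
rewrite -(commuteA (Lc _ 0 ku zu)).
rewrite -!mulgA; do 3 congr (_ * _)%g.
have kus : spform (e_ k) (u + s *: e_ (-% j)) = 0 by rewrite spformDr ku ksj addr0.
rewrite !mulgA !xUM ?addr0 //; apply: xU_congr.
  by rewrite uE /hyp /c; apply/colP => m; rewrite !mxE; ring.
by rewrite uE !spE zej' zj.1 zj.2 spform_ee /c; ring.
Qed.

End ShortRoots.

(** * Scaling, symmetry and additivity of short root elements *)
Section ThirdIndex.
Variables (R : comPzRingType) (l : nat) (hl : (3 <= l)%N).
Local Notation I := 'I_(2 * l).
Local Notation V := 'cV[R]_(2 * l).
Local Notation G := (StSp R l).
Local Notation "-% i" := (rev_ord i) (at level 35).
Implicit Types (i j k m : I) (u v w y z : V) (a b c p q r s t : R) (g : G).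

(** This is where l >= 3 enters. *)
Lemma third_index j k : exists i, apart i j /\ apart i k.
Proof.
have [i /negP] : exists i : I, ~ i \in [:: j; -% j; k; -% k].
  apply/not_existsP => h.
  have : (#|'I_(2 * l)| <= size [:: j; -% j; k; -% k])%N.
    apply: leq_trans (card_size _); apply: subset_leq_card.
    by apply/subsetP => i _; have /contrapT := h i.
  by rewrite card_ord /=; lia.
rewrite !inE !negb_or => /and4P[h1 h2 h3 h4].
by exists i; rewrite /apart h1 h2 h3 h4.
Qed.

Lemma hypZ j a r s : a *: hyp j r s = hyp j (a * r) (a * s).
Proof. by rewrite /hyp scalerDr !scalerA. Qed.

Lemma fixes_longT_hyp j k r s a : apart j k ->
  fixes (longT k (hyp j r s) a) k /\ fixes (longT k (hyp j r s) a) (-% k).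
Proof.
move=> jk; have [i [ij ik]] := third_index j k.
by apply: (fixes_longT2 (k := i)); rewrite 1?apartC //; apply: perp_hyp; rewrite // apartC.
Qed.

Lemma shortT_fix_hyp j z r s v : perp j z -> spform z v = 0 ->
  spform (hyp j r s) v = 0 -> rho (shortT j z r s) *m v = v.
Proof.
by move=> zj zv yv; rewrite rho_shortT // mulTmx zv yv mulr0 addr0 !scale0r !addr0.
Qed.

(** The shear along u + v is the shear along v followed by the one along u.
    Conjugating the long root element of e_k in two steps factors longT, up to
    the commutator g of the shear along u with x_k(va). *)
Lemma longT_add_gen k u v a (g : G) : perp k u -> perp k v -> spform u v = 0 ->
    cj (shear k u) (xU k (a *: v) 0) = (g * xU k (a *: v) 0)%g ->
    commute g (xU k (a *: u) 0) -> commute (longT k v a) (xU k (a *: u) 0) ->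
    commute (shear k u) (longT k v a) ->
  longT k (u + v) a = (longT k u a * longT k v a * g)%g.
Proof.
move=> uk vk uv cg gu vu Nv.
apply: (mulgI (xU k 0 a)); apply: (mulIg (xU k (a *: (u + v)) 0)).
rewrite -shear_long; last exact: perpD.
rewrite shearD // cjMl shear_long // !cjM shear_long // cg (cj_commute _ _).2 //.
have -> : xU k (a *: (u + v)) 0 = (xU k (a *: u) 0 * xU k (a *: v) 0)%g.
  by rewrite xUM ?spformZr ?spformZl ?uk.1 ?vk.1 ?uv ?mulr0 ?addr0 // scalerDr.
by rewrite !mulgA (commuteA gu) (commuteA vu).
Qed.

Section Pair.
Variables (j k : I) (jk : apart j k) (z : V) (zj : perp j z) (zk : perp k z).

Lemma shortT_fixes r s : fixes (shortT j z r s) k /\ fixes (shortT j z r s) (-% k).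
Proof.
have kj : apart k j by rewrite apartC.
by split; apply: fixes_shortT; rewrite ?apart_revl //; [exact: zk.1 | exact: zk.2].
Qed.

Lemma longT_fixes a : fixes (longT k z a) k /\ fixes (longT k z a) (-% k).
Proof. by apply: (fixes_longT2 (k := j)); rewrite // apartC. Qed.

Lemma form_hyp_r r s : spform z (hyp j r s) = 0.
Proof. exact: form_hyp. Qed.

Lemma form_hyp_l r s : spform (hyp j r s) z = 0.
Proof. by rewrite spform_skew form_hyp_r oppr0. Qed.

(** Lifts T(z + y,0,a) = T(z,0,a) T(y,0,a) T(z,ya,0), for y in H_j. *)
Lemma longT_add_hyp r s a : longT k (z + hyp j r s) a =
  (longT k z a * longT k (hyp j r s) a * shortT j z (a * r) (a * s))%g.
Proof.
have yk : perp k (hyp j r s : V) by exact: perp_hyp.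
have [S1 S2] := shortT_fixes (a * r) (a * s).
have [L1 L2] := fixes_longT_hyp r s a jk.
have kaz : spform (e_ k) (a *: z) = 0 by rewrite spformZr zk.1 mulr0.
apply: longT_add_gen => //; first exact: form_hyp_r.
- by rewrite hypZ shear_xU_hyp.
- apply: fixes_commute => //.
  by apply: shortT_fix_hyp; rewrite // spformZr ?spform_alt ?form_hyp_l mulr0.
- by apply: fixes_commute; rewrite // rho_longT // T_long_fix // spformZr form_hyp_l mulr0.
- apply: commute_sym; apply: fixes_commute => //; first exact: shear_perp.
  by rewrite rho_longT // T_long_fix // spformZr form_hyp_l mulr0.
Qed.

(** The same factorisation with the two shears performed in the other order.
    The commutator that arises is that of the key lemma with the roles of k
    and -k exchanged, hence the inverse and the signs. *)
Lemma longT_hyp_add r s a : longT k (hyp j r s + z) a =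
  (longT k (hyp j r s) a * longT k z a *
   (shortT j ((sgn k * a) *: z) (sgn (-% k) * r) (sgn (-% k) * s))^-1)%g.
Proof.
have yk : perp k (hyp j r s : V) by exact: perp_hyp.
have [L1 L2] := longT_fixes a.
have z'j : perp j ((sgn k * a) *: z) by exact: perpZ.
have z'k : perp k ((sgn k * a) *: z) by exact: perpZ.
have kj : apart k j by rewrite apartC.
have S1 : fixes (shortT j ((sgn k * a) *: z) (sgn (-% k) * r) (sgn (-% k) * s)) k.
  by apply: fixes_shortT => //; exact: z'k.1.
have kay : spform (e_ k) (a *: hyp j r s : V) = 0 by rewrite spformZr yk.1 mulr0.
apply: longT_add_gen => //; first exact: form_hyp_l.
- have jk' : apart j (-% k) by rewrite apart_rev.
  have := shear_xU_hyp (sgn (-% k) * r) (sgn (-% k) * s) jk' z'j (perp_rev z'k).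
  rewrite /shear !rev_ordK scalerA mulrA sgn_sqr mul1r -hypZ -/(shear k _) => e.
  rewrite cj_flip cjV e invgM -!mulgA mulVKg //.
- apply: commute_sym; apply: commuteV; apply: commute_sym.
  apply: fixes_commute => //; apply: shortT_fix_hyp => //.
    by rewrite spformZl spformZr form_hyp_r !mulr0.
  by rewrite -hypZ spformZl spformZr spform_alt !mulr0.
- by apply: fixes_commute; rewrite // rho_longT // T_long_fix // spformZr form_hyp_r mulr0.
- apply: commute_sym; apply: fixes_commute => //; first exact: shear_perp.
  by rewrite rho_longT // T_long_fix // spformZr form_hyp_r mulr0.
Qed.

Lemma longT_hyp_commute r s a b : commute (longT k z a) (longT k (hyp j r s) b).
Proof.
have [L1 L2] := longT_fixes a; apply: longT_commute => //; first exact: perp_hyp.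
by rewrite rho_longT // T_long_fix // form_hyp_r.
Qed.

Lemma shortT_flip r s a : shortT j z (a * r) (a * s) =
  (shortT j ((sgn k * a) *: z) (sgn (-% k) * r) (sgn (-% k) * s))^-1%g.
Proof.
apply: (mulgI (longT k z a * longT k (hyp j r s) a)%g).
by rewrite -longT_add_hyp longT_hyp_commute -longT_hyp_add addrC.
Qed.

End Pair.

(** Both sides are equal to the same right-hand side of [shortT_flip], once for
    the pair z, a and once for the pair az, 1. *)
Lemma shortT_scale j z a r s : (exists2 k, apart j k & perp k z) -> perp j z ->
  shortT j (a *: z) r s = shortT j z (a * r) (a * s).
Proof.
move=> [k jk zk] zj; rewrite (shortT_flip jk zj zk) -{1}[r]mul1r -{1}[s]mul1r.
rewrite (shortT_flip jk (perpZ _ zj) (perpZ _ zk)) scalerA mulr1 //.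
Qed.

(** Two vectors in distinct planes H_j and H_k: whichever of them is taken as
    the vector of the plane, [longT_add_hyp] over a third plane gives the short
    element as the same quotient of long root elements. *)
Lemma shortT_sym j k p q r s : apart j k ->
  shortT j (hyp k p q) r s = shortT k (hyp j r s) p q.
Proof.
move=> jk; have kj : apart k j by rewrite apartC.
have [i [ij ik]] := third_index j k.
have ji : apart j i by rewrite apartC.
have ki : apart k i by rewrite apartC.
have kyj : perp j (hyp k p q : V) by exact: perp_hyp.
have kyi : perp i (hyp k p q : V) by exact: perp_hyp.
have jyk : perp k (hyp j r s : V) by exact: perp_hyp.
have jyi : perp i (hyp j r s : V) by exact: perp_hyp.
have := longT_add_hyp ji kyj kyi r s 1; rewrite !mul1r => e1.
have := longT_add_hyp ki jyk jyi p q 1; rewrite !mul1r addrC e1.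
by rewrite (longT_hyp_commute ji kyj kyi) => /mulgI.
Qed.

(** Lifts T(z + y,v,0) = T(z,v,0) T(y,v,0), with v = p e_k + q e_-k and y in H_j.
    Interchanging x_k(py) with x_-k(qz) costs the commutator E^-1 of the key
    lemma, and factoring the long root element of z + y produces E. *)
Lemma shortT_add j k z p q r s : apart j k -> perp j z -> perp k z ->
  shortT k (z + hyp j r s) p q = (shortT k z p q * shortT k (hyp j r s) p q)%g.
Proof.
move=> jk zj zk; have kj : apart k j by rewrite apartC.
have yk : perp k (hyp j r s : V) by exact: perp_hyp.
set y := hyp j r s; set c := - (sgn k * p * q).
have zy : spform z y = 0 by exact: form_hyp_r.
have [E1 E2] := shortT_fixes jk zj zk (c * r) (c * s).
set E := shortT j z (c * r) (c * s) in E1 E2.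
have [L1 L2] := longT_fixes jk zj zk c.
have Ez : rho E *m z = z by apply: shortT_fix_hyp; rewrite ?spform_alt ?form_hyp_l.
have Ey : rho E *m y = y.
  apply: shortT_fix_hyp; rewrite // -hypZ spformZl spform_alt ?mulr0 //.
have Ly : rho (longT k z c) *m y = y by rewrite rho_longT // T_long_fix.
have flip : (xU k (p *: y) 0 * xU (-% k) (q *: z) 0 =
             E^-1 * xU (-% k) (q *: z) 0 * xU k (p *: y) 0)%g.
  have := shear_xU_hyp (p * r) (p * s) jk (perpZ (sgn (-% k) * q) zj) (perpZ (sgn (-% k) * q) zk).
  rewrite -hypZ -/y shortT_scale //; last by exists k.
  have -> : sgn (-% k) * q * (p * r) = c * r by rewrite sgn_rev /c; ring.
  have -> : sgn (-% k) * q * (p * s) = c * s by rewrite sgn_rev /c; ring.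
  rewrite -/E /shear scalerA mulrA sgn_sqr mul1r => /cj_slide e.
  by rewrite -mulgA e !mulgA mulVg mul1g.
have kz b : spform (e_ k) (b *: z) = 0 by rewrite spformZr zk.1 mulr0.
have kz' b : spform (e_ (-% k)) (b *: z) = 0 by rewrite spformZr zk.2 mulr0.
have ky b : spform (e_ k) (b *: y) = 0 by rewrite spformZr yk.1 mulr0.
have ky' b : spform (e_ (-% k)) (b *: y) = 0 by rewrite spformZr yk.2 mulr0.
have Lcy b : commute (longT k z c) (xU k (b *: y) 0).
  by apply: fixes_commute => //; rewrite -scalemxAr Ly.
have Lcy' b : commute (longT k z c) (xU (-% k) (b *: y) 0).
  by apply: fixes_commute => //; rewrite -scalemxAr Ly.
have Ecy b : commute E (xU k (b *: y) 0).
  by apply: fixes_commute => //; rewrite -scalemxAr Ey.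
have Ecy' b : commute E (xU (-% k) (b *: y) 0).
  by apply: fixes_commute => //; rewrite -scalemxAr Ey.
have Ecz' b : commute E (xU (-% k) (b *: z) 0).
  by apply: fixes_commute => //; rewrite -scalemxAr Ez.
have ELz : commute E (longT k z c) by exact: longT_commute.
have ELy : commute E (longT k y c) by exact: longT_commute.
have xadd m b : spform (e_ m) (b *: z) = 0 -> spform (e_ m) (b *: y) = 0 ->
    xU m (b *: (z + y)) 0 = (xU m (b *: z) 0 * xU m (b *: y) 0)%g.
  by move=> bz by_; rewrite xUM // spformZl spformZr zy !mulr0 !addr0 scalerDr.
rewrite !shortT_def -/c !xadd // longT_add_hyp // -/E -/y.
rewrite !mulgA -(mulgA (xU k (p *: z) 0)) flip !mulgA.
(* E acts trivially on z and y, so it moves left until it meets E^-1. *)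
rewrite -(commuteA ELy) -(commuteA ELz) -(commuteA (Ecy' _)) -(commuteA (Ecy _)).
rewrite -(commuteA (Ecz' _)) mulgVK.
by rewrite -(commuteA (Lcy' _)) -(commuteA (Lcy _)).
Qed.

End ThirdIndex.

(** * Equivariant long root elements of arbitrary vectors *)
Section Transvections.
Variables (R : comPzRingType) (l : nat) (hl : (3 <= l)%N).
Local Notation I := 'I_(2 * l).
Local Notation V := 'cV[R]_(2 * l).
Local Notation G := (StSp R l).
Local Notation "-% i" := (rev_ord i) (at level 35).
Implicit Types (i j k m : I) (u v w y z : V) (a b c p q r s t : R) (g : G).

Definition hpart k u : V := hyp k (u k 0) (u (-% k) 0).

(** The lift of T(u,0,a) read off from T(y + w,0,a) = T(y,0,a) T(w,0,a) T(w,ya,0)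
    with y in H_k and w orthogonal to H_k.  The index m only serves to lift
    T(y,0,a). *)
Definition longT_split k m u a : G := (longT m (hpart k u) a * longT k (u - hpart k u) a *
  shortT k (u - hpart k u) (a * u k 0) (a * u (-% k) 0))%g.

Lemma hyp_coord k r s : (hyp k r s : V) k 0 = r /\ (hyp k r s : V) (-% k) 0 = s.
Proof.
rewrite /hyp !mxE !eqxx (negbTE (rev_ord_neq k)).
by rewrite (negbTE (rev_ord_neqC k)) /= !(mulr0, mulr1, addr0, add0r).
Qed.

Lemma perp_coordP k w : w k 0 = 0 -> w (-% k) 0 = 0 -> perp k w.
Proof. by move=> h1 h2; split; apply/perp_coord; rewrite ?rev_ordK. Qed.

Lemma perp_hpart k u : perp k (u - hpart k u).
Proof.
have [h1 h2] := hyp_coord k (u k 0) (u (-% k) 0).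
have E (v w : V) n : (v - w) n 0 = v n 0 - w n 0 by rewrite !mxE.
by apply: perp_coordP; rewrite E /hpart ?h1 ?h2 subrr.
Qed.

Lemma coord_perp k w : perp k w -> w k 0 = 0 /\ w (-% k) 0 = 0.
Proof. by case=> /perp_coord h1 /perp_coord; rewrite rev_ordK. Qed.

(** If m = -j, a third plane connects the two. *)
Lemma longT_hyp_indep j k m r s a : apart j k -> apart m k ->
  longT j (hyp k r s) a = longT m (hyp k r s) a.
Proof.
move=> jk mk; have [i [ij ik]] := third_index hl j k.
have yP n : apart n k -> perp n (hyp k r s : V).
  by move=> nk; apply: perp_hyp; rewrite apartC.
have [im|nim] := boolP (apart i m).
  by rewrite -(@longT_indep _ _ i j) ?(@longT_indep _ _ i m) //; apply: yP.
have [jm|] := boolP (apart j m); first by apply: longT_indep => //; apply: yP.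
rewrite /apart negb_and !negbK => /orP[/eqP ->//|/eqP jm].
by move: ij; rewrite jm apart_rev (negbTE nim).
Qed.

Lemma fixes_longT_hyp_apart j k m r s a : apart j k -> apart m k ->
  fixes (longT j (hyp k r s) a) m.
Proof.
move=> jk mk; have [i [im ik]] := third_index hl m k.
rewrite (longT_hyp_indep r s a jk ik); apply: fixes_longT.
- by rewrite apartC.
- by apply: perp_hyp; rewrite apartC.
- by have [] : perp m (hyp k r s : V) by apply: perp_hyp; rewrite apartC.
Qed.

Lemma rho_longT_hyp j k r s a : apart j k ->
  rho (longT j (hyp k r s) a) = T (hyp k r s) 0 a.
Proof. by move=> jk; apply/rho_longT/perp_hyp; rewrite apartC. Qed.

Lemma hyp00 k : hyp k 0 0 = 0 :> V.
Proof. by rewrite /hyp !scale0r addr0. Qed.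

Lemma shortT00 k w : shortT k w 0 0 = 1%g.
Proof. by rewrite shortT_def !scale0r !xU0 mulr0 oppr0 longT_0 !mulg1. Qed.

Lemma hpart_perp k w : perp k w -> hpart k w = 0.
Proof. by move=> /coord_perp[h1 h2]; rewrite /hpart h1 h2 hyp00. Qed.

Lemma split_perp k m w a : perp k w -> longT_split k m w a = longT k w a.
Proof.
move=> wk; have [h1 h2] := coord_perp wk.
by rewrite /longT_split hpart_perp // h1 h2 mulr0 shortT00 longT0 subr0 mul1g mulg1.
Qed.

(** Write u as the sum of its components y_k in H_k, y_j in H_j and z in the
    complement.  Both sides factor into the three long root elements and the three
    short root elements of these components; the factors A, B, C are the long
    ones, E and F the short ones involving z, and the short element of y_j and
    y_k is common to both sides by symmetry and scaling.  It remains to commute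
    A, B, C among themselves, and E with F. *)
Lemma split_indep j k m m' u a : apart j k -> apart m k -> apart m' j ->
  longT_split k m u a = longT_split j m' u a.
Proof.
move=> jk mk mj; have kj : apart k j by rewrite apartC.
have yjk : perp j (hpart k u) by exact: perp_hyp.
have ykj : perp k (hpart j u) by exact: perp_hyp.
set p := u k 0; set q := u (-% k) 0; set r := u j 0; set s := u (-% j) 0.
set z := u - hpart k u - hpart j u.
have zk : perp k z.
  by apply: perpD; [exact: perp_hpart | rewrite -scaleN1r; apply: perpZ].
have zE : z = u - hpart j u - hpart k u by rewrite /z addrAC.
have zj : perp j z.
  by rewrite zE; apply: perpD; [exact: perp_hpart | rewrite -scaleN1r; apply: perpZ].
have uk : u - hpart k u = z + hyp j r s by rewrite /z subrK.
have uj : u - hpart j u = z + hyp k p q by rewrite zE subrK.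
rewrite /longT_split uk uj -/p -/q -/r -/s (longT_add_hyp hl jk zj zk) (longT_add_hyp hl kj zk zj).
rewrite (shortT_add hl _ _ _ _ jk) // (shortT_add hl _ _ _ _ kj) //.
have Sjk : shortT j (hyp k p q) (a * r) (a * s) = shortT k (hyp j r s) (a * p) (a * q).
  rewrite (shortT_sym hl) // -hypZ (shortT_scale hl) //.
  have [i [ik ij]] := third_index hl k j.
  by exists i; rewrite 1?apartC //; apply: perp_hyp; rewrite apartC.
rewrite Sjk [longT m _ _](longT_hyp_indep _ _ _ mk jk).
rewrite [longT m' _ _](longT_hyp_indep _ _ _ mj kj).
rewrite (longT_indep a kj) // -/p -/q -/r -/s.
have [i [ij ik]] := third_index hl j k.
set A := longT j (hyp k p q) a; set B := longT k (hyp j r s) a; set C := longT j z a.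
set E := shortT j z (a * r) (a * s); set F := shortT k z (a * p) (a * q).
have fA n : apart n k -> fixes A n by move=> nk; exact: fixes_longT_hyp_apart.
have fB n : apart n j -> fixes B n by move=> nj; exact: fixes_longT_hyp_apart.
have zyk : spform (hyp k p q) z = 0 by apply: form_hyp_l.
have zyj : spform (hyp j r s) z = 0 by apply: form_hyp_l.
have AB : commute A B.
  rewrite /B (longT_hyp_indep r s a kj ij); apply: longT_commute.
  - exact: fA.
  - by apply: fA; rewrite apart_revl.
  - by apply: perp_hyp; rewrite apartC.
  - by rewrite rho_longT_hyp // T_long_fix // form_hyp.
have AC : commute A C.
  apply: longT_commute => //; [exact: fA | by apply: fA; rewrite apart_revl |].
  by rewrite rho_longT_hyp // T_long_fix.
have BC : commute B C.
  rewrite /C (longT_indep a jk) //.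
  apply: longT_commute => //; [exact: fB | by apply: fB; rewrite apart_revl |].
  by rewrite rho_longT_hyp // T_long_fix.
have EF : commute E F.
  have [E1 E2] := shortT_fixes jk zj zk (a * r) (a * s).
  have Ez : rho E *m z = z by apply: shortT_fix_hyp; rewrite ?spform_alt // form_hyp_l.
  rewrite /F shortT_def; do ?apply: commuteM.
  - by apply: fixes_commute; rewrite ?spformZr ?zk.1 ?mulr0 // -scalemxAr Ez.
  - by apply: fixes_commute; rewrite ?spformZr ?zk.2 ?mulr0 // -scalemxAr Ez.
  - by apply: longT_commute.
rewrite !mulgA; congr (_ * _)%g; rewrite -2!mulgA -2![in RHS]mulgA.
rewrite !mulgA -(commuteA EF); do 2 congr (_ * _)%g.
by rewrite -mulgA -BC; exact: commuteM.
Qed.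

Lemma fixes_apart (p q : I) k c : apart k p -> apart k q ->
  fixes (stX p q c : G) k /\ fixes (stX p q c : G) (-% k).
Proof.
move=> /andP[kp kp'] /andP[kq kq']; split; apply: fixes_stX => //.
  by rewrite eq_sym rev_ord_eqC.
by rewrite (inj_eq rev_ord_inj).
Qed.

Lemma stX_commute g (p q : I) c : p != q -> fixes g p -> fixes g q -> fixes g (-% q) ->
  commute g (stX p q c).
Proof.
move=> npq gp gq [ge' _]; have [qp|nqp] := eqVneq q (-% p).
  by rewrite qp stX_long; apply: fixes_commute; rewrite ?spform0r ?mulmx0.
rewrite stX_short //; apply: fixes_commute => //; first exact: spform_Tel.
by rewrite -scalemxAr ge'.
Qed.

Lemma shortT_levi g k w r s : fixes g k -> fixes g (-% k) -> perp k w ->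
  cj g (shortT k w r s) = shortT k (rho g *m w) r s.
Proof.
move=> gk gk' wk; rewrite !shortT_def !cjM longT_levi // (fixes_cj _ gk) ?(fixes_cj _ gk').
- by rewrite -!scalemxAr.
- by rewrite spformZr wk.2 mulr0.
- by rewrite spformZr wk.1 mulr0.
Qed.

(** An element fixing e_k and e_-k preserves the decomposition of u. *)
Lemma split_levi g k m u a : fixes g k -> fixes g (-% k) ->
    commute g (longT m (hpart k u) a) ->
  cj g (longT_split k m u a) = longT_split k m (rho g *m u) a.
Proof.
move=> gk gk' gL; have [ge _] := gk; have [ge' _] := gk'.
have e1 : (rho g *m u) k 0 = u k 0 by rewrite !coordE fixes_perp.
have e2 : (rho g *m u) (-% k) 0 = u (-% k) 0.
  by rewrite !(coordE _ (-% k)) rev_ordK fixes_perp.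
have hE : hpart k (rho g *m u) = hpart k u by rewrite /hpart e1 e2.
have wk := perp_hpart k u.
have wE : rho g *m u - hpart k u = rho g *m (u - hpart k u).
  by rewrite mulmxBr {2}/hpart /hyp mulmxDr -!scalemxAr ge ge'.
by rewrite /longT_split hE e1 e2 wE !cjM ((cj_commute _ _).2 gL) longT_levi // shortT_levi.
Qed.

Lemma split_stX (p q : I) k m c u a : p != q -> apart k p -> apart k q -> apart m k ->
  cj (stX p q c) (longT_split k m u a) = longT_split k m (rho (stX p q c : G) *m u) a.
Proof.
move=> npq kp kq mk; have [X1 X2] := fixes_apart c kp kq.
apply: split_levi => //; apply: commute_sym; apply: stX_commute => //.
- by apply: fixes_longT_hyp_apart; rewrite // apartC.
- by apply: fixes_longT_hyp_apart; rewrite // apartC.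
- by apply: fixes_longT_hyp_apart; rewrite // apartC apart_rev.
Qed.

Fact lt0_2l : (0 < 2 * l)%N. Proof. by lia. Qed.
Fact lt1_2l : (1 < 2 * l)%N. Proof. by lia. Qed.

(** The equivariant lift of T(u,0,a) for an arbitrary vector u.  The chosen
    pair of distinct planes is immaterial by [longXE]. *)
Definition longX : V -> R -> G := locked_with steinberg_key
  (longT_split (Ordinal lt0_2l) (Ordinal lt1_2l)).

Lemma longXE k m u a : apart m k -> longX u a = longT_split k m u a.
Proof.
move=> mk; rewrite /longX unlock.
have a10 : apart (Ordinal lt1_2l) (Ordinal lt0_2l).
  by apply/andP; split=> //; apply/eqP => /(congr1 val) /=; lia.
have [i [i0 ik]] := third_index hl (Ordinal lt0_2l) k.
rewrite (split_indep (j := i) (m' := k)) //; last by rewrite apartC.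
by apply: split_indep => //; rewrite apartC.
Qed.

Lemma longX_perp k w a : perp k w -> longX w a = longT k w a.
Proof.
move=> wk; have [i [ik _]] := third_index hl k k.
by rewrite (longXE _ _ ik) split_perp.
Qed.

(** Equivariance.  A generator X_pq avoids some plane H_k, and longX can be
    computed with respect to that plane. *)
Lemma longX_cj g u a : cj g (longX u a) = longX (rho g *m u) a.
Proof.
elim/StSp_ind: g u => [u|g g' IH IH' u|g IH u|p q c npq u].
- by rewrite cj1l rho1 mul1mx.
- by rewrite cjMl IH' IH mulmxA -rhoM.
- by apply: cjK; rewrite IH mulmxA rhoK mul1mx.
have [k [kp kq]] := third_index hl p q; have [m [mk _]] := third_index hl k k.
by rewrite !(longXE _ _ mk); apply: split_stX.
Qed.

Lemma longX0 a : longX 0 a = 1%g.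
Proof. by rewrite (longX_perp (k := Ordinal lt0_2l)) ?longT0 //; exact: perp0. Qed.

Lemma longX_0 u : longX u 0 = 1%g.
Proof.
have [m [mk _]] := third_index hl (Ordinal lt0_2l) (Ordinal lt0_2l).
by rewrite (longXE _ _ mk) /longT_split !longT_0 !mul0r shortT00 !mulg1.
Qed.

Lemma longX_add_line i w p a : perp i w ->
  longX (w + p *: e_ i) a =
    (xU i 0 (a * p ^+ 2) * longT i w a * xU i ((a * p) *: w) 0)%g.
Proof.
move=> wi; have [m [mi _]] := third_index hl i i; rewrite (longXE _ _ mi).
have im : apart i m by rewrite apartC.
have [w1 w2] := coord_perp wi; set u := w + p *: e_ i.
have u1 : u i 0 = p by rewrite /u !mxE w1 !eqxx mulr1 add0r.
have u2 : u (-% i) 0 = 0.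
  by rewrite /u !mxE w2 (negbTE (rev_ord_neq i)) mulr0 addr0.
have hu : hpart i u = p *: e_ i by rewrite /hpart /hyp u1 u2 scale0r addr0.
have wE : u - hpart i u = w by rewrite hu /u addrK.
rewrite /longT_split wE hu u1 u2 shortT_def mulr0 scale0r xU0 mulr0 oppr0 longT_0 !mulg1.
rewrite -[p *: e_ i]add0r longT_add_e ?spform0r //; last exact: perp0.
by rewrite longT0 scaler0 xU0 !mulg1.
Qed.

Lemma longX_commute g u a : rho g *m u = u -> commute g (longX u a).
Proof. by move=> gu; apply/cj_commute; rewrite longX_cj gu. Qed.

(** The lift of T(v + c e_i,0,a) = T(v,0,a) T(e_i, vac, ac^2); here v may have a
    component along e_i. *)
Lemma longX_add_e i v a c : spform (e_ i) v = 0 ->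
  longX (v + c *: e_ i) a = (longX v a * xU i ((a * c) *: v) (a * c ^+ 2))%g.
Proof.
move=> vi; set p := v i 0; set w : V := v - hpart i v.
have wi : perp i w by exact: perp_hpart.
have q0 : v (-% i) 0 = 0 by apply/perp_coord.
have vE : v = w + p *: e_ i.
  have hp : hpart i v = p *: e_ i by rewrite /hpart /hyp q0 scale0r addr0.
  by rewrite /w -hp subrK.
rewrite vE; clearbody w p; rewrite -addrA -scalerDl !longX_add_line //.
rewrite scalerDr scalerA xU_P4 ?spformZr ?wi.1 ?mulr0 // -!mulgA.
rewrite xUM ?spformZr ?wi.1 ?mulr0 // spformZl spform_alt !mulr0 addr0 add0r.
have Lc b : commute (longT i w a) (xU i 0 b).
  rewrite -(longX_perp _ wi); apply: commute_sym; apply: longX_commute.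
  by rewrite rho_xU ?spform0r // T_long_fix // wi.1.
set b := a * c ^+ 2 + 2 * (a * c * p).
have -> : xU i ((a * p) *: w + (a * c) *: w) b =
    (xU i 0 b * xU i ((a * (p + c)) *: w) 0)%g.
  rewrite xUM ?spformZr ?wi.1 ?spform0r ?mulr0 // add0r -scalerDl -mulrDr.
  by rewrite spform0l mulr0 !addr0.
rewrite !mulgA (commuteA (Lc b)) xUM ?spform0r // !addr0.
by congr (xU _ _ _ * _ * _)%g; rewrite /b; ring.
Qed.

Lemma longX_line i a c : longX (c *: e_ i) a = xU i 0 (a * c ^+ 2).
Proof. by rewrite -[c *: e_ i]add0r longX_add_e ?spform0r // longX0 mul1g scaler0. Qed.

(** The lift of T(u,v,a).  For <u,v> = 0 the identity
      T(u,v,a) = T(u,0,a) T(u,0,-1) T(v,0,-1) T(u+v,0,1)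
    expresses it by long root elements, so equivariance is automatic. *)
Definition stT u v a : G := (longX u a * (longX u 1)^-1 * (longX v 1)^-1 * longX (u + v) 1)%g.

Lemma stT_cj g u v a : cj g (stT u v a) = stT (rho g *m u) (rho g *m v) a.
Proof. by rewrite /stT !cjM !cjV !longX_cj mulmxDr. Qed.

Lemma stT_e i v a : spform (e_ i) v = 0 -> stT (e_ i) v a = xU i v a.
Proof.
move=> vi; have := longX_add_e 1 1 vi; rewrite scale1r expr1n !mulr1 scale1r => e.
have line b : longX (e_ i) b = xU i 0 b by rewrite -[e_ i]scale1r longX_line expr1n mulr1.
rewrite /stT addrC e !line xUV ?spform0r // oppr0 -!mulgA mulKg.
have x0D b b' : (xU i 0 b * xU i v b' = xU i v (b + b'))%g.
  by rewrite xUM ?spform0r // spform0l addr0 add0r.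
by rewrite !x0D; congr xU; ring.
Qed.

(** Together with [stT_e] this is P2 for u = e_i. *)
Lemma stT_r_e i v a : spform (e_ i) v = 0 -> stT v (a *: e_ i) 0 = xU i (a *: v) 0.
Proof.
move=> vi; rewrite /stT longX_0 mul1g longX_add_e // longX_line !mul1r.
have vi' : spform v (e_ i) = 0 by rewrite spform_skew vi oppr0.
have c : commute (longX v 1) (xU i 0 (a ^+ 2)).
  apply: commute_sym; apply: longX_commute.
  by rewrite rho_xU ?spform0r // T_long_fix.
rewrite mulgA -(mulgA _ _ (longX v 1)) -(commuteV c) mulKg xUV ?spform0r // oppr0.
have vai : spform (e_ i) (a *: v) = 0 by rewrite spformZr vi mulr0.
by rewrite xUM ?spform0r // spform0l add0r addr0 addNr.
Qed.

Lemma stT_long u a : stT u 0 a = longX u a.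
Proof. by rewrite /stT addr0 longX0 invg1 mulg1 mulgVK. Qed.

End Transvections.

(** * The map from the second presentation *)
Section Presentations.
Variables (R : comPzRingType) (l : nat) (hl : (3 <= l)%N).
Local Notation I := 'I_(2 * l).
Local Notation V := 'cV[R]_(2 * l).
Local Notation G := (StSp R l).
Local Notation H := (VdkSp R l).
Local Notation "-% i" := (rev_ord i) (at level 35).
Implicit Types (i j k m : I) (u v w y z : V) (a b c p q r s t : R) (g : G).
Local Notation stT := (stT hl).

Lemma multiplicative_cj (K K' : groupType) (f : {multiplicative K -> K'}) (x y : K) :
  f (cj x y) = cj (f x) (f y).
Proof. by rewrite !cjE !gmulfM multiplicativeV. Qed.

(** Reduction of statements about a column u and vectors orthogonal to it to
    the case u = e_i. *)
Lemma elem_col_base u : elem_col u -> exists g i, u = rho g *m e_ i /\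
  forall v, spform u v = 0 -> exists2 v', v = rho g *m v' & spform (e_ i) v' = 0.
Proof.
case/elem_colP => g [i ->]; exists g, i; split=> // v uv.
have vE : v = rho g *m (rho g^-1%g *m v) by rewrite mulmxA rhoK mul1mx.
by exists (rho g^-1%g *m v); rewrite // -(rho_form g) -vE.
Qed.

Lemma rho_stT u v a : vdk_ok u v -> rho (stT u v a) = T u v a.
Proof.
case=> /elem_col_base[g [i [-> hv]]] /hv[v' -> v'i].
rewrite -stT_cj stT_e // rho_cj rho_xU // (Tconj _ _ _ (rho_form g)).
by rewrite -mulmxA rhoK mulmx1.
Qed.

Lemma elem_col_T u v a w : vdk_ok u v -> elem_col w -> elem_col (T u v a *m w).
Proof. by move=> uv wc; rewrite -rho_stT //; exact: elem_col_rho. Qed.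

Definition vdk_to_st_gen (x : Vdk_gen R l) : G := stT (val x).1.1 (val x).1.2 (val x).2.

Lemma vdk_to_st_genE u v a (h : vdk_ok u v) : vdk_to_st_gen (vdk_gen a h) = stT u v a.
Proof. by []. Qed.

(** P1 and P2 are moved to u = e_i by equivariance, and P3 is equivariance. *)
Lemma vdk_to_st_rel (w1 w2 : word (Vdk_gen R l)) :
  Vdk_rel w1 w2 -> weval vdk_to_st_gen w1 = weval vdk_to_st_gen w2.
Proof.
case=> {w1 w2}.
- move=> u v w a b hv hw hvw; rewrite weval_cat !weval_gen !vdk_to_st_genE.
  have [g [i [uE hg]]] := elem_col_base hv.1.
  have [v' -> v'i] := hg _ hv.2; have [w' -> w'i] := hg _ hw.2; rewrite uE.
  rewrite -mulmxDr rho_form -!stT_cj -cjM !stT_e ?spformDr ?v'i ?w'i ?addr0 //.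
  by rewrite xUM.
- move=> u v a hu hv; rewrite !weval_gen !vdk_to_st_genE.
  have [g [i [uE hg]]] := elem_col_base hu.1; case/hg=> v' -> v'i; rewrite uE.
  by rewrite !scalemxAr -!stT_cj stT_e ?spformZr ?v'i ?mulr0 // stT_r_e.
- move=> u v a u' v' b h h' hT; rewrite !weval_cat weval_inv !weval_gen !vdk_to_st_genE.
  by rewrite mulgA -cjE stT_cj rho_stT.
Qed.

Definition vdk_to_st : {multiplicative H -> G} := pres_lift vdk_to_st_rel.

Lemma vdk_to_stE u v a (h : vdk_ok u v) : vdk_to_st (VdkX u v a h) = stT u v a.
Proof. exact: pres_lift_gen. Qed.

(** The generator X(u,v,a) of the second presentation, extended by 1 to
    arguments for which it is not defined. *)
Definition vdkY u v a : H :=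
  match pselect (vdk_ok u v) with left h => VdkX u v a h | right _ => 1%g end.

Lemma vdkYE u v a (h : vdk_ok u v) : vdkY u v a = VdkX u v a h.
Proof.
rewrite /vdkY; case: pselect => // h'; congr (pres_gen _ _); rewrite /vdk_gen.
by congr exist; exact: bool_irrelevance.
Qed.

Lemma vdkY_P1 u v w a b : vdk_ok u v -> vdk_ok u w ->
  (vdkY u v a * vdkY u w b = vdkY u (v + w) (a + b + spform v w))%g.
Proof.
move=> hv hw; have hvw : vdk_ok u (v + w).
  by case: hv hw => uc uv [_ uw]; split; rewrite // spformDr uv uw addr0.
rewrite !vdkYE; have := pres_gen_rel (Vdk_P1 a b hv hw hvw).
by rewrite weval_cat !weval_gen.
Qed.

Lemma vdkY_P2 u v a : elem_col u -> elem_col v -> spform u v = 0 ->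
  vdkY u (a *: v) 0 = vdkY v (a *: u) 0.
Proof.
move=> uc vc uv; have hu := vdk_okZ a uc uv; have hv := vdk_okZC a vc uv.
by rewrite !vdkYE; have := pres_gen_rel (Vdk_P2 hu hv uv); rewrite !weval_gen.
Qed.

Lemma vdkY_P3 u v a u' v' b : vdk_ok u' v' -> vdk_ok u v ->
  cj (vdkY u' v' b) (vdkY u v a) = vdkY (T u' v' b *m u) (T u' v' b *m v) a.
Proof.
move=> h' h; have hT : vdk_ok (T u' v' b *m u) (T u' v' b *m v).
  by split; [exact: elem_col_T h.1 | rewrite -rho_stT // rho_form; exact: h.2].
rewrite !vdkYE cjE; have := pres_gen_rel (Vdk_P3 a h h' hT).
by rewrite !weval_cat weval_inv !weval_gen mulgA.
Qed.

(** The elements that are to play the role of X_ij(a); compare Tel. *)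
Definition vdk_el i j a : H :=
  if j == -% i then vdkY (e_ i) 0 a
  else vdkY (e_ i) ((a * sgn (-% j)) *: e_ (-% j)) 0.

Lemma vdk_ok_e0 i : vdk_ok (e_ i : V) 0.
Proof. exact/vdk_ok0/elem_col_e. Qed.

Lemma vdk_ok_eZ i k c : k != -% i -> vdk_ok (e_ i : V) (c *: e_ k).
Proof. by move=> h; apply: vdk_okZ; [exact: elem_col_e | exact: spform_e0]. Qed.

Lemma vdk_el_cj i j a u v b : i != j -> vdk_ok u v ->
  cj (vdk_el i j a) (vdkY u v b) = vdkY (Tel i j a *m u) (Tel i j a *m v) b.
Proof.
move=> nij uv; rewrite /vdk_el /Tel; case: ifP => [_|/negbT nj].
  by rewrite vdkY_P3 //; exact: vdk_ok_e0.
by rewrite vdkY_P3 //; exact: vdk_ok_e.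
Qed.

Lemma vdk_el_short i j a : j != -% i ->
  vdk_el i j a = vdkY (e_ i) ((a * sgn (-% j)) *: e_ (-% j)) 0.
Proof. by rewrite /vdk_el => /negbTE ->. Qed.

Lemma vdk_el_long i a : vdk_el i (-% i) a = vdkY (e_ i) 0 a.
Proof. by rewrite /vdk_el eqxx. Qed.

Lemma vdkY_sym i k c : k != -% i -> vdkY (e_ i) (c *: e_ k) 0 = vdkY (e_ k) (c *: e_ i) 0.
Proof. by move=> ki; apply: vdkY_P2; [exact: elem_col_e..| exact: spform_e0]. Qed.

Lemma vdk_el_R0 i j a : i != j -> vdk_el i j a = vdk_el (-% j) (-% i) (- (a * sgn i * sgn j)).
Proof.
move=> nij; have [->|nj] := eqVneq j (-% i).
  rewrite rev_ordK !vdk_el_long sgn_rev; congr vdkY.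
  transitivity (a * (sgn i * sgn i)); last by ring.
  by rewrite sgn_sqr mulr1.
have nj' : -% i != -% (-% j) by rewrite rev_ordK eq_sym.
have nij' : -% j != -% i by rewrite (inj_eq rev_ord_inj) eq_sym.
rewrite vdk_el_short // vdk_el_short // rev_ordK vdkY_sym //; congr (vdkY _ (_ *: _) _).
rewrite sgn_rev.
by transitivity (- (a * sgn j) * (sgn i * sgn i)); [rewrite sgn_sqr|]; ring.
Qed.

End Presentations.

(** * The Steinberg relations in the second presentation *)
Section Inverse.
Variables (R : comPzRingType) (l : nat) (hl : (3 <= l)%N).
Local Notation I := 'I_(2 * l).
Local Notation V := 'cV[R]_(2 * l).
Local Notation G := (StSp R l).
Local Notation H := (VdkSp R l).
Local Notation "-% i" := (rev_ord i) (at level 35).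
Implicit Types (i j k m : I) (u v w y z : V) (a b c p q r s t : R) (g : G).
Local Notation spE := (spE R l).
Local Notation stT := (stT hl).
Local Notation vdk_to_st := (vdk_to_st R hl).

Lemma vdk_el_R1 i j a b : i != j -> (vdk_el i j a * vdk_el i j b = vdk_el i j (a + b))%g.
Proof.
move=> nij; have [->|nj] := eqVneq j (-% i).
  rewrite !vdk_el_long vdkY_P1 ?spform0r ?addr0 //; exact: vdk_ok_e0.
rewrite !vdk_el_short // vdkY_P1 ?spE ?mulr0 ?addr0; try exact: vdk_ok_e.
by rewrite -scalerDl -mulrDl.
Qed.

Lemma vdk_el_R2 i j (h : I) k a b : i != j -> h != k ->
  h != j -> h != -% i -> k != i -> k != -% j ->
  cj (vdk_el i j a) (vdk_el h k b) = vdk_el h k b.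
Proof.
move=> nij nhk hj hi ki kj; have e : Tel i j a *m e_ (-% k) = e_ (-% k).
  by rewrite Tel_e // ?(inj_eq rev_ord_inj) // eq_sym rev_ord_eqC.
rewrite {2 3}/vdk_el; case: ifP => _; rewrite (vdk_el_cj hl) ?Tel_e ?mulmx0 //.
- exact: vdk_ok_e0.
- by rewrite -scalemxAr e.
- exact: vdk_ok_e.
Qed.

(** By P3, conjugation turns e_j into e_j + a e_i in the first argument; P2
    moves this sum to the second argument, where P1 splits it.  The same
    argument proves R4. *)
Lemma vdk_el_R3 i j k a b : i != j -> j != k -> i != k ->
    i != -% j -> i != -% k -> j != -% k ->
  cj (vdk_el i j a) (vdk_el j k b) = (vdk_el i k (a * b) * vdk_el j k b)%g.
Proof.
move=> nij njk nik ij ik jk.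
have ji : j != -% i by rewrite rev_ord_eqC.
have ki : k != -% i by rewrite rev_ord_eqC.
have kj : k != -% j by rewrite rev_ord_eqC.
have ok : vdk_ok (e_ j : V) ((b * sgn (-% k)) *: e_ (-% k)) by exact: vdk_ok_e.
have e1 : Tel i j a *m e_ (-% k) = e_ (-% k).
  by rewrite Tel_e // ?(inj_eq rev_ord_inj) // 1?eq_sym // eq_sym.
have e2 : Tel i j a *m e_ j = e_ j + a *: e_ i by rewrite Tel_ej.
have col : elem_col (Tel i j a *m e_ j).
  by rewrite -rho_stX //; exact: rho_elem.
have kI : -% k != -% i by rewrite (inj_eq rev_ord_inj) eq_sym.
have kJ : -% k != -% j by rewrite (inj_eq rev_ord_inj) eq_sym.
have iK : i != -% (-% k) by rewrite rev_ordK.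
have jK : j != -% (-% k) by rewrite rev_ordK.
have yj : vdk_el j k b = vdkY (e_ j) ((b * sgn (-% k)) *: e_ (-% k)) 0.
  by rewrite vdk_el_short.
rewrite {1}yj (vdk_el_cj hl) // -scalemxAr e1 vdkY_P2 //; first last.
- by rewrite -e1 -rho_stX // rho_form spform_e0.
- exact: elem_col_e.
rewrite e2 yj vdk_el_short // !(vdkY_sym _ kI) !(vdkY_sym _ kJ).
rewrite vdkY_P1; first last.
- exact: vdk_ok_eZ.
- exact: vdk_ok_eZ.
rewrite spformZl spformZr spform_e0 // !mulr0 !addr0 scalerDr scalerA addrC.
by congr (vdkY _ (_ *: _ + _) _); ring.
Qed.

Lemma vdk_el_R4 i j a b : i != j -> -% i != j ->
  cj (vdk_el i (-% i) a) (vdk_el (-% i) j b) =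
  (vdk_el i j (a * b * sgn i) * vdk_el (-% j) j (- (a * b ^+ 2)) * vdk_el (-% i) j b)%g.
Proof.
move=> nij nj; have ii : i != -% i by exact: rev_ord_neqC.
have ji : j != -% i by rewrite eq_sym.
have jI : j != -% (-% i) by rewrite rev_ordK eq_sym.
have JI : -% j != -% i by rewrite (inj_eq rev_ord_inj) eq_sym.
have JI' : -% j != -% (-% i) by rewrite (inj_eq rev_ord_inj).
have e1 : Tel i (-% i) a *m e_ (-% j) = e_ (-% j) by rewrite Tel_e.
have e2 : Tel i (-% i) a *m e_ (-% i) = e_ (-% i) + (a * sgn i) *: e_ i.
  by rewrite Tel_long mulTmx spform0l add0r spform_ee scaler0 addr0.
have col : elem_col (Tel i (-% i) a *m e_ (-% i)).
  by rewrite -rho_stX //; exact: rho_elem.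
have IJ : i != -% (-% j) by rewrite rev_ordK.
have IJ' : -% i != -% (-% j) by rewrite rev_ordK.
have yi : vdk_el (-% i) j b = vdkY (e_ (-% i)) ((b * sgn (-% j)) *: e_ (-% j)) 0.
  by rewrite vdk_el_short.
rewrite {1}yi (vdk_el_cj hl) //; last by apply: vdk_ok_e.
rewrite -scalemxAr e1 vdkY_P2 //; first last.
- by rewrite -e1 -rho_stX // rho_form spform_e0.
- exact: elem_col_e.
rewrite e2 yi vdk_el_short // !(vdkY_sym _ JI) !(vdkY_sym _ JI').
have -> : vdk_el (-% j) j (- (a * b ^+ 2)) = vdkY (e_ (-% j)) 0 (- (a * b ^+ 2)).
  by rewrite -{2}[j]rev_ordK vdk_el_long.
rewrite !vdkY_P1 ?addr0; first last.
- exact: vdk_ok_e0.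
- exact: vdk_ok_eZ.
- exact: vdk_ok_eZ.
- exact: vdk_ok_eZ.
rewrite spform0r addr0 spformZl spformZr spform_ee add0r; congr vdkY.
  by rewrite scalerDr scalerA addrC; congr (_ *: _ + _); ring.
transitivity (a * b ^+ 2 * ((sgn i * sgn i) * (sgn (-% j) * sgn (-% j)) - 1)).
  by rewrite !sgn_sqr mul1r subrr mulr0.
ring.
Qed.

(** Both factors have the form X(e_i, _, 0), so that P1 computes their
    commutator. *)
Lemma vdk_el_R5 i j a b : i != j -> j != -% i ->
  (vdk_el i j a * vdk_el j (-% i) b =
   vdk_el i (-% i) (2 * a * b * sgn i) * (vdk_el j (-% i) b * vdk_el i j a))%g.
Proof.
move=> nij nj; have IJ : -% i != -% j by rewrite (inj_eq rev_ord_inj).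
have yj : vdk_el j (-% i) b = vdkY (e_ i) ((b * sgn i) *: e_ j) 0.
  by rewrite vdk_el_short // rev_ordK vdkY_sym // rev_ord_eqC.
have oj : vdk_ok (e_ i : V) ((b * sgn i) *: e_ j) by exact: vdk_ok_eZ.
have oi : vdk_ok (e_ i : V) ((a * sgn (-% j)) *: e_ (-% j)) by exact: vdk_ok_e.
have oij : vdk_ok (e_ i : V) ((b * sgn i) *: e_ j + (a * sgn (-% j)) *: e_ (-% j)).
  by split; [exact: elem_col_e | rewrite spformDr oi.2 oj.2 addr0].
rewrite vdk_el_long yj vdk_el_short // !vdkY_P1 //; last exact: vdk_ok_e0.
have vw : spform ((a * sgn (-% j)) *: e_ (-% j)) ((b * sgn i) *: e_ j) = a * b * sgn i.
  rewrite spformZl spformZr -{3}[j]rev_ordK spform_ee.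
  transitivity (a * b * sgn i * (sgn (-% j) * sgn (-% j))); first by ring.
  by rewrite sgn_sqr mulr1.
rewrite spform0l vw (spform_skew ((a * sgn (-% j)) *: e_ (-% j))) vw.
by rewrite [0 + (_ + _)]add0r [_ + (a * _) *: _]addrC; congr vdkY; ring.
Qed.

Definition st_to_vdk_gen (x : St_gen R l) : H := vdk_el (val x).1.1 (val x).1.2 (val x).2.

Lemma st_to_vdk_rel (w1 w2 : word (St_gen R l)) :
  St_rel w1 w2 -> weval st_to_vdk_gen w1 = weval st_to_vdk_gen w2.
Proof.
have E i j a (h : i != j) : st_to_vdk_gen (st_gen a h) = vdk_el i j a by [].
case=> {w1 w2}.
- by move=> i j a h h'; rewrite !weval_gen !E vdk_el_R0.
- by move=> i j a b h; rewrite weval_cat !weval_gen !E vdk_el_R1.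
- move=> i j h k a b hij hhk hj hi ki kj; rewrite weval_comm !E.
  by rewrite -cjE vdk_el_R2 // mulgV.
- move=> i j k a b hij hjk hik ij ik jk; rewrite weval_comm weval_gen !E.
  by rewrite -cjE vdk_el_R3 // mulgK.
- move=> i j a b h1 h2 h3 h4; rewrite weval_comm weval_cat !weval_gen !E.
  by rewrite -cjE vdk_el_R4 // mulgK.
- move=> i j a b h1 h2 h3; rewrite weval_comm weval_gen !E.
  by apply: comm_eq; exact: vdk_el_R5.
Qed.

Definition st_to_vdk : {multiplicative G -> H} := pres_lift st_to_vdk_rel.

Lemma st_to_vdk_X i j a : i != j -> st_to_vdk (stX i j a) = vdk_el i j a.
Proof. by move=> h; rewrite (stXE a h); exact: pres_lift_gen. Qed.

(** On generators this is P3. *)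
Lemma st_to_vdk_cj g u v a : vdk_ok u v ->
  cj (st_to_vdk g) (vdkY u v a) = vdkY (rho g *m u) (rho g *m v) a.
Proof.
have okr h u' v' : vdk_ok u' v' -> vdk_ok (rho h *m u') (rho h *m v').
  by move=> [uc uv]; split; [exact: elem_col_rho | rewrite rho_form].
elim/StSp_ind: g u v => [u v _|g g' IH IH' u v uv|g IH u v uv|i j b nij u v uv].
- by rewrite multiplicative1 cj1l rho1 !mul1mx.
- by rewrite gmulfM cjMl IH' // IH ?rhoM ?mulmxA //; exact: okr.
- rewrite multiplicativeV; apply: cjK; rewrite IH; last exact: okr.
  by rewrite !mulmxA rhoK !mul1mx.
- by rewrite st_to_vdk_X // (vdk_el_cj hl) // rho_stX.
Qed.

(** P4 for u = e_i in the second presentation.  For v and w orthogonal to e_i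
    with <v,w> = c, conjugate X(e_i,w,0) by X(e_i,v,0): P3 gives the factor
    X(e_i, e_i c, 0), and P1 the factor X(e_i, 0, 2c). *)
Lemma vdkY_P4_e i c : vdkY (e_ i) (c *: e_ i) 0 = vdkY (e_ i : V) 0 (2 * c).
Proof.
have [j [ji _]] := third_index hl i i; have [nji nji'] := andP ji.
have ii := rev_ord_neqC i.
set v : V := e_ j; set w : V := (c * sgn j) *: e_ (-% j).
have nJi : -% j != -% i by rewrite (inj_eq rev_ord_inj).
have ov : vdk_ok (e_ i) v by rewrite -[v]scale1r; exact: vdk_ok_eZ.
have ow : vdk_ok (e_ i) w by exact: vdk_ok_eZ.
have oi : vdk_ok (e_ i : V) (c *: e_ i) by exact: vdk_ok_eZ.
have vw : spform v w = c.
  by rewrite spformZr spform_ee -mulrA sgn_sqr mulr1.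
have ovw : vdk_ok (e_ i) (v + w).
  by split; [exact: elem_col_e | rewrite spformDr ov.2 ow.2 addr0].
clearbody v w.
have e : cj (vdkY (e_ i) v 0) (vdkY (e_ i) w 0) = (vdkY (e_ i) (c *: e_ i) 0 * vdkY (e_ i) w 0)%g.
  rewrite (vdkY_P3 hl) // !mulTmx vdkY_P1 // vw (spform_skew (e_ i) v) ov.2 spform_alt.
  rewrite spformZl ow.2 oppr0.
  by rewrite !(mulr0, mul0r, addr0, scale0r) addrC.
apply: (mulIg (vdkY (e_ i) w 0)); rewrite -e; apply: (mulIg (vdkY (e_ i) v 0)).
have ok00 := vdk_ok_e0 R i; have wv := addrC v w.
rewrite cjE mulgVK -mulgA !vdkY_P1 // -?wv // spform0l wv add0r.
by rewrite (spform_skew v w) vw [0 + (w + v)]add0r; congr vdkY; ring.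
Qed.

Lemma st_to_vdk_xU i v a : spform (e_ i) v = 0 -> st_to_vdk (xU i v a) = vdkY (e_ i) v a.
Proof.
move=> vi; elim/perp_ind: v / vi a => [a|v k c ki vi IHv a].
  by rewrite -stX_long st_to_vdk_X ?rev_ord_neqC // vdk_el_long.
have -> : a = a - spform v (e_ k) * c + spform v (e_ k) * c by ring.
rewrite -xU_xgen // gmulfM IHv.
have -> : st_to_vdk (xgen i k c) = vdkY (e_ i) (c *: e_ k) 0.
  rewrite /xgen; case: eqP => [->|/eqP nki].
    by rewrite st_to_vdk_X ?rev_ord_neqC // vdk_el_long vdkY_P4_e.
  rewrite st_to_vdk_X 1?rev_ord_eqC // vdk_el_short ?(inj_eq rev_ord_inj) //.
  by rewrite rev_ordK -mulrA sgn_sqr mulr1.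
rewrite vdkY_P1; last exact: vdk_ok_eZ; last by split=> //; exact: elem_col_e.
by rewrite spformZr; congr vdkY; ring.
Qed.

(** Write u = g e_i: both sides are conjugates, by the image of g, of the
    corresponding elements for e_i. *)
Lemma st_to_vdk_stT u v a : vdk_ok u v -> st_to_vdk (stT u v a) = vdkY u v a.
Proof.
case=> /elem_col_base[g [i [-> hv]]] /hv[v' -> v'i].
rewrite -stT_cj stT_e // multiplicative_cj st_to_vdk_xU // st_to_vdk_cj //.
by split=> //; exact: elem_col_e.
Qed.

Lemma vdk_to_stK : cancel vdk_to_st st_to_vdk.
Proof.
apply: presented_ind => [|x y ex ey|x ex|[[[u v] a] /= h]].
- by rewrite !multiplicative1.
- by rewrite !gmulfM ex ey.
- by rewrite !multiplicativeV ex.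
- have h' := asboolW h.
  have -> : pres_gen (Vdk_rel (R:=R) (l:=l)) (exist _ (u, v, a) h) = VdkX u v a h'.
    by congr pres_gen; congr exist; exact: bool_irrelevance.
  by rewrite vdk_to_stE st_to_vdk_stT // vdkYE.
Qed.

Lemma st_to_vdkK : cancel st_to_vdk vdk_to_st.
Proof.
apply: StSp_ind => [|x y ex ey|x ex|i j a nij].
- by rewrite !multiplicative1.
- by rewrite !gmulfM ex ey.
- by rewrite !multiplicativeV ex.
rewrite st_to_vdk_X //; have [->|nj] := eqVneq j (-% i).
  by rewrite vdk_el_long (vdkYE _ (vdk_ok_e0 _ i)) vdk_to_stE stT_e ?spform0r // stX_long.
by rewrite vdk_el_short // (vdkYE _ (vdk_ok_e a nij)) vdk_to_stE stT_e ?spform_Tel // stX_short.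
Qed.

End Inverse.

Theorem mainTheorem5 (R : comPzRingType) (l : nat) (hl : (3 <= l)%N) :
  (exists f : {multiplicative VdkSp R l -> StSp R l},
    [/\ bijective f,
        forall (i j : 'I_(2 * l)) (a : R) (hij : i != j), j != rev_ord i ->
          f (VdkX (e_ i) ((a * sgn (rev_ord j)) *: e_ (rev_ord j)) 0
               (vdk_ok_e a hij)) = StX i j a hij,
        forall (i : 'I_(2 * l)) (a : R) (hi : i != rev_ord i),
          f (VdkX (e_ i) 0 a (vdk_ok0 (elem_col_e R i)))
            = StX i (rev_ord i) a hi
      & forall (u v : 'cV[R]_(2 * l)) (a : R) (h : vdk_ok u v),
          phi R l (f (VdkX u v a h)) = T u v a :> 'M[R]_(2 * l)]) /\
  [/\ forall (u : 'cV[R]_(2 * l)) (a : R) (hu : elem_col u),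
        VdkX u (a *: u) 0 (vdk_okZ a hu (spform_alt u))
          = VdkX u 0 (2 * a) (vdk_ok0 hu),
      forall (u : 'cV[R]_(2 * l)) (a b : R)
             (hu : elem_col u) (hub : elem_col (b *: u)),
        VdkX (b *: u) 0 a (vdk_ok0 hub) = VdkX u 0 (a * b ^+ 2) (vdk_ok0 hu)
    & forall (u v : 'cV[R]_(2 * l)) (a : R) (hu : elem_col u)
             (hv : elem_col v) (huv : elem_col (u + v)) (h : spform u v = 0),
        VdkX (u + v) 0 a (vdk_ok0 huv)
          = (VdkX u 0 a (vdk_ok0 hu) * VdkX v 0 a (vdk_ok0 hv)
             * VdkX v (a *: u) 0 (vdk_okZC a hv h))%g].
Proof.
have finj := can_inj (@vdk_to_stK R l hl).
split.
  exists (vdk_to_st R hl); split.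
  - by exists (st_to_vdk R hl); [exact: vdk_to_stK | exact: st_to_vdkK].
  - move=> i j a hij nj; rewrite vdk_to_stE stT_e ?spform_Tel // -stX_short //; exact: stXE.
  - move=> i a hi; rewrite vdk_to_stE stT_e ?spform0r // -stX_long; exact: stXE.
  - by move=> u v a h; rewrite vdk_to_stE; exact: rho_stT.
split=> [u a hu|u a b hu hub|u v a hu hv huv h]; apply: finj.
- rewrite !vdk_to_stE; have [g [i [-> _]]] := elem_col_base hu.
  have ei : spform (e_ i) (a *: e_ i) = 0 by rewrite spformZr spform_alt mulr0.
  rewrite scalemxAr -[X in _ = stT _ _ X _](mulmx0 _ (rho g)) -!stT_cj.
  by rewrite !stT_e ?spform0r // -[a *: _]add0r xU_P4 ?spform0r // add0r.
- rewrite !vdk_to_stE !stT_long; have [g [i [-> _]]] := elem_col_base hu.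
  by rewrite scalemxAr -!longX_cj longX_line -[e_ i in RHS]scale1r longX_line expr1n mulr1.
rewrite !gmulfM !vdk_to_stE !stT_long; have [g [i [uE hg]]] := elem_col_base hu.
have [v' -> v'i] := hg v h; rewrite uE -mulmxDr scalemxAr -!longX_cj -stT_cj -!cjM.
have := longX_add_e hl a 1 v'i; rewrite scale1r mulr1 expr1n mulr1 addrC => ->.
rewrite stT_r_e //; congr cj.
have -> : longX hl (e_ i) a = xU i 0 a by rewrite -[e_ i]scale1r longX_line expr1n mulr1.
have -> : commute (xU i 0 a) (longX hl v' a).
  by apply: longX_commute; rewrite rho_xU ?spform0r // T_long_fix.
rewrite -mulgA xUM ?spform0r ?spformZr ?v'i ?mulr0 //; congr (_ * _)%g.
by rewrite add0r addr0 spform0l mulr0 addr0.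
Qed.
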